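(* Let $f$ be an admissible polynomial. For $a,k,n\in\mathbb{Z}_+$ (with $a,k$ possibly varying with $n$) such that $\gcd(k,\Pi_f)=1$, $$p_f(a,k;n)\sim k^{-1}p_f(n),$$ as $n\to\infty$, holds for $k=o\left(n^{\frac{1}{2+2\deg(f)}}(\log n)^{-\frac12}\right)$.
   Context: Admissible polynomial: $f(x)\in\mathbb{Q}[x]$ is a nonconstant polynomial that is integer-valued (i.e. $f(\mathbb{Z})\subseteq\mathbb{Z}$), satisfies $f(\ell)>0$ for all integers $\ell\ge 1$, and is such that for every prime $p$ there exists an integer $\ell$ with $p\nmid f(\ell)$. $\Pi_f$ is the product over primes $p$ of $p^{s}$, where $p^s$ is the largest power of $p$ dividing $f(\ell)-f(0)$ for all $\ell\in\mathbb{Z}$; equivalently $\Pi_f=\gcd\{f(\ell)-f(0):\ell\in\mathbb{Z}\}$. $p_f(n)$ is the number of partitions of $n$ whose parts are taken from the sequence $\{f(\ell)\}_{\ell=1}^\infty$, and $p_f(m,n)$ is the number of those with exactly $m$ parts (if a value occurs several times in the sequence, its occurrences count as distinct kinds of part), so that $$\sum_{n\ge 0}p_f(n)q^n=\prod_{n\ge1}\frac{1}{1-q^{f(n)}},\qquad \sum_{m,n\ge 0}p_f(m,n)\zeta^mq^n=\prod_{n\ge1}\frac{1}{1-\zeta q^{f(n)}}$$ for complex $q$ with $|q|<1$ and complex $\zeta$ with $|\zeta|<1/|q|$. For $k\in\mathbb{Z}_+$ and $a\in\mathbb{Z}$, $p_f(a,k;n):=\sum_{m\ge 0,\ m\equiv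 a\ (\mathrm{mod}\ k)}p_f(m,n)$, the number of such partitions of $n$ whose number of parts is congruent to $a$ modulo $k$. *)

(* Defs.v *)
From mathcomp Require Import all_boot all_order all_algebra.
From mathcomp Require Import finmap multiset.
From mathcomp Require Import all_classical all_reals all_analysis.

Set Implicit Arguments.
Unset Strict Implicit.
Unset Printing Implicit Defensive.

Import Order.TTheory GRing.Theory Num.Theory.

Local Open Scope classical_set_scope.
Local Open Scope ring_scope.

(* The value f(l) as an integer; the floor is exact when f is
   integer-valued. *)
Definition int_value (f : {poly rat}) (l : int) : int := Num.floor f.[l%:~R].

Definition poly_deg (f : {poly rat}) : nat := (size f).-1.

Definition admissible (f : {poly rat}) : Prop :=
  [/\ (0 < poly_deg f)%N,
      forall l : int, f.[l%:~R] \is a Num.int,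
      forall l : int, 1 <= l -> 0 < f.[l%:~R] &
      forall p : nat, prime p -> exists l : int, ~~ (p%:Z %| int_value f l)%Z].

Definition pow_dvd_diffs (f : {poly rat}) (p s : nat) : Prop :=
  forall l : int, ((p ^ s)%N%:Z %| int_value f l - int_value f 0)%Z.

(* The largest s such that p ^ s divides every f(l) - f(0); it exists for p
   prime and f integer-valued and nonconstant (the default 0 is then unused). *)
Definition max_pow (f : {poly rat}) (p : nat) : nat :=
  xget 0%N [set s | pow_dvd_diffs f p s /\
                    forall t, pow_dvd_diffs f p t -> (t <= s)%N].

(* Finitely supported product: p ^ max_pow f p = 1 for almost all primes. *)
Definition Pi_ (f : {poly rat}) : nat :=
  \big[muln/1%N]_(p \in [set p : nat | prime p]) (p ^ max_pow f p)%N.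

(* A partition of n is a finite multiset of indices l >= 1, so that equal
   values f(l) at different l are different kinds of part. *)
Definition partitions (f : {poly rat}) (n : nat) : set {mset nat}%mset :=
  [set A : {mset nat}%mset |
     0%N \notin A /\ \sum_(l <- A) int_value f l%:Z = n%:Z].

Definition partitions_parts (f : {poly rat}) (m n : nat) : set {mset nat}%mset :=
  [set A : {mset nat}%mset | partitions f n A /\ size A = m].

(* These sets are finite for f admissible (fset_set is empty on an infinite
   set). *)
Definition pf (f : {poly rat}) (n : nat) : nat :=
  #|` fset_set (partitions f n)|.

Definition pf_parts (f : {poly rat}) (m n : nat) : nat :=
  #|` fset_set (partitions_parts f m n)|.

(* Finitely supported sum: pf_parts f m n = 0 for m > n. *)
Definition pf_mod (f : {poly rat}) (a : int) (k n : nat) : nat :=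
  \big[addn/0%N]_(m \in [set m : nat | (m%:Z == a %[mod k%:Z])%Z])
    pf_parts f m n.

(* Main.v *)
Require Import Defs.
From mathcomp Require Import all_boot all_order all_algebra.
From mathcomp Require Import finmap multiset.
From mathcomp Require Import all_classical all_reals all_analysis.
From mathcomp Require Import zify ring lra.

Set Implicit Arguments.
Unset Strict Implicit.
Unset Printing Implicit Defensive.

Import Order.TTheory GRing.Theory Num.Theory.
Import numFieldNormedType.Exports.

Local Open Scope classical_set_scope.
Local Open Scope ring_scope.

(** Write a partition of [n] as the vector of its multiplicities. Finite differences of order
    [deg f + 1] vanish, so an integer relation between finitely many values of [f] whose
    coefficients add up to [gcd (f l - f 0)] can be transported to arguments close to the
    multiples of any large [h]. This gives about [n^(1/(deg f + 1))] relations with disjoint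
    supports and bounded coefficients; adding one of them to a partition preserves [n] and
    changes the number of parts by a constant coprime to [k]. Pairing neighbouring partitions
    along each relation multiplies a nontrivial character sum by [cos (pi m / k)], which is at
    most [exp (- 1 / (2 k^2))] in absolute value, for every relation that is applicable.
    A relation is applicable as soon as the multiplicities on its support are bounded below.
    Under the Boltzmann weights [exp (- x N)] this fails for half of the relations with
    exponentially small probability; tuning [x] so that the mean of [N] is [(1 - eps) n] and
    using that [p_f] is nondecreasing up to a bounded shift, the same holds for a uniform
    partition of [n], with no precise asymptotics of [p_f] being needed. *)

(** * Truncated geometric sums *)

(** Let [d] be the degree and [Y] the integer part of [n^(1/(d+1))]. A fixed fraction of [Y]
    relations is available, while [k - 1] nontrivial characters must be summed, so
    [k * exp (- c * Y / k^2)] has to tend to zero; this is what [k^2 * log n = o(Y)] provides. The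
    obstacle is the transfer from Boltzmann weights to uniform partitions of [n]. The temperature
    has [x] of order [Y^(-d)], so [x * n] is of order [Y], and centering at [(1 - eps) * n] loses
    [exp (O (eps * Y))]. The gain, a power of [exp (- Y / E)], is of the same exponential order.
    Hence the relations are confined to the indices below [Y / E], the constant [E] is fixed first,
    and [eps] is then a small multiple of [1 / E]. As the window may have width proportional to [n],
    a second moment estimate replaces any local limit theorem. The two arithmetic conditions act in
    different places. Every prime factor of the change in the number of parts divides all
    [f l - f 0], hence [Pi_f]. The absence of a prime dividing all values makes every large integer
    a sum of parts, which yields the monotonicity up to a shift. *)

Lemma sum_geo_mean (R : comNzRingType) (Q : R) b :
  (\sum_(r < b.+1) r%:R * Q ^+ r) * (1 - Q) =
  Q * (\sum_(r < b.+1) Q ^+ r) - b.+1%:R * Q ^+ b.+1.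
Proof.
elim: b => [|b IH]; first by rewrite !big_ord1 /= expr0 expr1; ring.
rewrite big_ord_recr [in RHS]big_ord_recr /= mulrDl IH -!natr1 !exprS; ring.
Qed.

Lemma sum_geo_sqr (R : comNzRingType) (Q : R) b :
  (\sum_(r < b.+1) r%:R ^+ 2 * Q ^+ r) * (1 - Q) =
  Q * (2 * (\sum_(r < b.+1) r%:R * Q ^+ r) + \sum_(r < b.+1) Q ^+ r)
  - b.+1%:R ^+ 2 * Q ^+ b.+1.
Proof.
elim: b => [|b IH]; first by rewrite !big_ord1 /= expr0 expr1; ring.
rewrite big_ord_recr /= mulrDl IH.
rewrite (big_ord_recr b.+1 (fun i => i%:R * Q ^+ i)) /=.
rewrite (big_ord_recr b.+1 (fun i => Q ^+ i)) /= -!(natr1 b.+1) !exprS.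
set s1 := \sum_(i < _) _; set s2 := \sum_(i < _) _; ring.
Qed.

Section TruncatedGeometric.
Variables (R : realFieldType) (Q : R) (b : nat).
Hypotheses (Q0 : 0 < Q) (Q1 : Q < 1).

Local Notation G := (\sum_(r < b.+1) Q ^+ r).

Lemma geo_gt0 : 0 < G.
Proof.
rewrite big_ord_recl expr0 ltr_wpDr ?ltr01 // sumr_ge0 // => i _.
by rewrite exprn_ge0 // ltW.
Qed.

Lemma geo_mean_le : \sum_(r < b.+1) r%:R * Q ^+ r <= Q / (1 - Q) * G.
Proof.
have h : 0 < 1 - Q by rewrite subr_gt0.
rewrite -(ler_pM2r h) sum_geo_mean.
have -> : Q / (1 - Q) * G * (1 - Q) = Q * G by field; lra.
by rewrite gerBl mulr_ge0 // exprn_ge0 // ltW.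
Qed.

(** The untruncated second moment is [Q * (1 + Q) / (1 - Q) ^+ 2]; truncation only subtracts
    nonnegative boundary terms, and [1 + Q <= 2]. *)
Lemma geo_sqr_le :
  \sum_(r < b.+1) r%:R ^+ 2 * Q ^+ r <= 2 * Q / (1 - Q) ^+ 2 * G.
Proof.
have h : 0 < 1 - Q by rewrite subr_gt0.
have G0 := geo_gt0.
rewrite -(ler_pM2r h) sum_geo_sqr.
apply: (@le_trans _ _ (Q * (2 * (Q / (1 - Q) * G) + G))).
  rewrite -[leRHS]subr0; apply: lerB.
    by rewrite ler_pM2l // lerD2r ler_pM2l ?geo_mean_le.
  by rewrite mulr_ge0 ?exprn_ge0 // ltW.
have -> : 2 * Q / (1 - Q) ^+ 2 * G * (1 - Q) = Q * (2 / (1 - Q) * G).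
  by field; lra.
rewrite ler_pM2l //.
have -> : 2 * (Q / (1 - Q) * G) + G = (1 + Q) / (1 - Q) * G by field; lra.
by rewrite ler_pM2r // ler_pM2r ?invr_gt0 //; lra.
Qed.

Lemma geo_ge s : (s <= b.+1)%N -> s%:R * Q ^+ s <= G.
Proof.
move=> sb; rewrite -(big_mkord xpredT (fun r => Q ^+ r)) (big_cat_nat (leq0n s) sb) //=.
rewrite ler_wpDr ?sumr_ge0 // => [i _|]; first by rewrite exprn_ge0 // ltW.
rewrite mulr_natl -[X in _ *+ X](subn0 s) -sumr_const_nat.
apply: ler_sum_nat => i /andP[_ is_]; by apply: ler_wiXn2l; [exact: ltW|exact: ltW|lia].
Qed.

(** The block of exponents from [s] to [2 * s - 1] is [Q ^+ s] times the initial block, so the tail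
    from [s] on carries at least the share [Q ^+ s / 2] of the total, and every exponent in it is at
    least [s]. *)
Lemma geo_mean_ge s : (2 * s <= b.+1)%N ->
  s%:R * Q ^+ s / 2 * G <= \sum_(r < b.+1) r%:R * Q ^+ r.
Proof.
move=> sb; have sb' : (s <= b.+1)%N by lia.
pose T := \sum_(s <= r < b.+1) Q ^+ r.
have Gs : G = \sum_(0 <= r < s) Q ^+ r + T.
  by rewrite -(big_mkord xpredT (fun r => Q ^+ r)) (big_cat_nat (leq0n s) sb').
have TG : Q ^+ s * \sum_(0 <= r < s) Q ^+ r <= T.
  rewrite /T mulr_sumr [leRHS](@big_cat_nat _ _ _ (s + s)%N) //=; try lia.
  rewrite ler_wpDr ?sumr_ge0 // => [i _|]; first by rewrite exprn_ge0 // ltW.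
  rewrite -{3}[s]add0n big_addn addnK; apply: ler_sum => i _.
  by rewrite exprD mulrC.
have Qs1 : Q ^+ s <= 1 by rewrite exprn_ile1 // ltW.
have Qs0 : 0 <= Q ^+ s by rewrite exprn_ge0 // ltW.
have T0 : 0 <= T by rewrite sumr_ge0 // => i _; rewrite exprn_ge0 // ltW.
have hT : Q ^+ s / 2 * G <= T by rewrite Gs; nra.
apply: (@le_trans _ _ (s%:R * T)).
  by rewrite -!mulrA ler_wpM2l ?ler0n // mulrA.
rewrite -(big_mkord xpredT (fun r => r%:R * Q ^+ r)) (big_cat_nat (leq0n s) sb') //=.
rewrite ler_wpDl ?sumr_ge0 // => [i _|]; first by rewrite mulr_ge0 // exprn_ge0 // ltW.
rewrite mulr_sumr; apply: ler_sum_nat => i /andP[si _].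
by rewrite ler_wpM2r ?ler_nat // exprn_ge0 // ltW.
Qed.

Lemma geo_head_le B : \sum_(r < b.+1 | (r < B)%N) Q ^+ r <= B%:R.
Proof.
apply: (@le_trans _ _ (\sum_(0 <= r < B) 1)); last by rewrite big_const_nat iter_addr_0 subn0.
rewrite -(big_mkord (fun r => (r < B)%N) (fun r => Q ^+ r)).
rewrite [leRHS](@big_nat_widen _ _ _ _ _ (maxn b.+1 B)) ?leq_maxr //.
rewrite (@big_nat_widen _ _ _ _ _ (maxn b.+1 B)) ?leq_maxl //.
rewrite big_mkcond [leRHS]big_mkcond /=; apply: ler_sum => r _.
have := exprn_ile1 r (ltW Q0) (ltW Q1); have := exprn_ge0 r (ltW Q0).
by case: (r < B)%N; case: (r < b.+1)%N => /=; lra.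
Qed.
End TruncatedGeometric.

(** * Boltzmann weights on multiplicity vectors *)

(* [w i] is the multiplicity of the part [f (i + 1)]. The cap [b] only makes the type finite:
   it is harmless for vectors of mass [n] once [n <= b]. *)
Local Notation conf M b := {ffun 'I_M -> 'I_b.+1}.

Definition mass (a : nat -> nat) M b (w : conf M b) : nat :=
  (\sum_(i < M) a i * w i)%N.

Lemma sum_conf_prod (R : comNzSemiRingType) M b (F : 'I_M -> nat -> R) :
  \sum_(w : conf M b) \prod_i F i (w i) = \prod_i \sum_(r < b.+1) F i r.
Proof. by rewrite bigA_distr_bigA. Qed.

Section Boltzmann.
Variables (R : realFieldType) (a : nat -> nat) (M b : nat) (q : R).
Hypotheses (q0 : 0 < q) (q1 : q < 1) (a_gt0 : forall i, (0 < a i)%N).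

Local Notation Q i := (q ^+ a i).

Definition geo (i : nat) : R := \sum_(r < b.+1) Q i ^+ r.
Definition partition_function : R := \prod_(i < M) geo i.
(** Under the weights [q ^+ mass a w] the coordinates are independent truncated geometric variables
    of ratio [q ^+ a i]; this is the expectation of one of them. *)
Definition mean_mult (i : nat) : R := (\sum_(r < b.+1) r%:R * Q i ^+ r) / geo i.
Definition mean_mass : R := \sum_(i < M) (a i)%:R * mean_mult i.

Lemma qpow_gt0 i : 0 < Q i. Proof. by rewrite exprn_gt0. Qed.
Lemma qpow_lt1 i : Q i < 1.
Proof. by rewrite exprn_ilt1 ?ltW // -lt0n. Qed.

Lemma geo_pos i : 0 < geo i. Proof. exact: geo_gt0 (qpow_gt0 i). Qed.

Lemma partition_function_gt0 : 0 < partition_function.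
Proof. by rewrite prodr_gt0 // => i _; exact: geo_pos. Qed.

Lemma expr_mass (w : conf M b) : q ^+ mass a w = \prod_(i < M) Q i ^+ w i.
Proof. by rewrite /mass expr_sum; apply: eq_bigr => i _; rewrite exprM. Qed.

Lemma sum_weight_prod (F : 'I_M -> nat -> R) :
  \sum_(w : conf M b) q ^+ mass a w * \prod_i F i (w i) =
  \prod_i \sum_(r < b.+1) F i r * Q i ^+ r.
Proof.
rewrite -(sum_conf_prod b (fun i r => F i r * Q i ^+ r)).
by apply: eq_bigr => w _; rewrite expr_mass big_split /= mulrC.
Qed.

Lemma sum_weight : \sum_(w : conf M b) q ^+ mass a w = partition_function.
Proof.
have := sum_weight_prod (fun _ _ => 1).
rewrite (eq_bigr (fun w : conf M b => q ^+ mass a w)) => [->|w _]; last first.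
  by rewrite big1 ?mulr1.
by apply: eq_bigr => i _; apply: eq_bigr => r _; rewrite mul1r.
Qed.

Lemma sum_weight1 (phi : nat -> R) (i : 'I_M) :
  \sum_(w : conf M b) q ^+ mass a w * phi (w i) =
  partition_function * ((\sum_(r < b.+1) phi r * Q i ^+ r) / geo i).
Proof.
have := sum_weight_prod (fun j r => if j == i then phi r else 1).
rewrite (eq_bigr (fun w : conf M b => q ^+ mass a w * phi (w i))) => [->|w _]; last first.
  by rewrite (bigD1 i) //= eqxx big1 ?mulr1 // => j /negPf->.
 rewrite (bigD1 i) //= eqxx /partition_function [X in _ = X * _](bigD1 i) //=.
rewrite [X in _ * X = _](eq_bigr (fun j : 'I_M => geo j)) => [|j /negPf->].
  by have := geo_pos i; set p := \prod_(_ < _ | _) _; move=> h; field; lra.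
by apply: eq_bigr => r _; rewrite mul1r.
Qed.

(** Independence of distinct coordinates: the factor of a centred function vanishes. This kills the
    off-diagonal terms of the variance. *)
Lemma sum_weight2 (phi psi : nat -> R) (i j : 'I_M) : i != j ->
  \sum_(r < b.+1) phi r * Q i ^+ r = 0 ->
  \sum_(w : conf M b) q ^+ mass a w * (phi (w i) * psi (w j)) = 0.
Proof.
move=> ij phi0.
have := sum_weight_prod
  (fun k r => if k == i then phi r else if k == j then psi r else 1).
rewrite [X in _ = X](bigD1 i) //= eqxx phi0 mul0r => prod0; rewrite -[RHS]prod0.
apply: eq_bigr => w _; congr (_ * _).
rewrite (bigD1 i) //= eqxx (bigD1 j) /=; last by rewrite eq_sym.
rewrite eq_sym (negPf ij) eqxx big1 ?mulr1 // => k /andP[/negPf-> /negPf->].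
by [].
Qed.

Lemma sum_weight_mass :
  \sum_(w : conf M b) q ^+ mass a w * (mass a w)%:R = partition_function * mean_mass.
Proof.
under eq_bigr do rewrite /mass natr_sum mulr_sumr.
rewrite exchange_big /= mulr_sumr; apply: eq_bigr => i _.
under eq_bigr do rewrite natrM.
rewrite (sum_weight1 (fun r => (a i)%:R * r%:R) i).
congr (_ * _); rewrite /mean_mult mulrA; congr (_ / _).
by rewrite mulr_sumr; apply: eq_bigr => r _; rewrite mulrA.
Qed.

Lemma variance_le :
  \sum_(w : conf M b) q ^+ mass a w * ((mass a w)%:R - mean_mass) ^+ 2 <=
  partition_function * \sum_(i < M) (a i)%:R ^+ 2 *
     ((\sum_(r < b.+1) r%:R ^+ 2 * Q i ^+ r) / geo i).
Proof.
pose c (i : 'I_M) (r : nat) : R := (a i)%:R * (r%:R - mean_mult i).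
have cent (i : 'I_M) : \sum_(r < b.+1) c i r * Q i ^+ r = 0.
  rewrite /c; under eq_bigr do rewrite -mulrA mulrBl mulrBr.
  rewrite sumrB -!mulr_sumr -mulrBr.
  by rewrite /mean_mult -/(geo i) divfK ?subrr ?mulr0 // gt_eqF // geo_pos.
have E w : (mass a w)%:R - mean_mass = \sum_(i < M) c i (w i).
  rewrite /mass natr_sum /mean_mass -sumrB; apply: eq_bigr => i _.
  by rewrite natrM /c mulrBr.
under eq_bigr => w _ do rewrite E expr2 mulr_suml mulr_sumr.
rewrite exchange_big mulr_sumr /=; apply: ler_sum => i _.
under eq_bigr => w _ do rewrite mulr_sumr mulr_sumr.
rewrite exchange_big /= (bigD1 i) //= [X in _ + X]big1 ?addr0 => [|j ji].
  have -> : \sum_(w : conf M b) q ^+ mass a w * (c i (w i) * c i (w i)) =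
    partition_function * ((\sum_(r < b.+1) (c i r * c i r) * Q i ^+ r) / geo i).
    exact: (sum_weight1 (fun r => c i r * c i r)).
  rewrite ler_pM2l ?partition_function_gt0 // mulrA ler_pM2r ?invr_gt0 ?geo_pos //.
  pose S := \sum_(r < b.+1) r%:R * Q i ^+ r.
  pose T := \sum_(r < b.+1) r%:R ^+ 2 * Q i ^+ r.
  have -> : \sum_(r < b.+1) c i r * c i r * Q i ^+ r =
     (a i)%:R ^+ 2 * (T - 2 * mean_mult i * S + mean_mult i ^+ 2 * geo i).
    rewrite /T /S /geo !mulr_sumr -sumrB -big_split /= mulr_sumr.
    by apply: eq_bigr => r _; rewrite /c; ring.
  rewrite ler_wpM2l ?exprn_ge0 ?ler0n // -/T.
  have -> : S = mean_mult i * geo i by rewrite /mean_mult divfK // gt_eqF // geo_pos.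
  by have := sqr_ge0 (mean_mult i); have := geo_pos i; nra.
by apply: (sum_weight2 (phi := c i) (c j)) => //; rewrite eq_sym.
Qed.
End Boltzmann.

(** * Moments for parts of polynomial growth *)

Lemma expRN_half_ge (R : realType) (u : R) : u <= 1 / 2 -> 1 / 2 <= expR (- u).
Proof. by move=> u2; apply: le_trans (expR_ge1Dx _); lra. Qed.

(** The quotient is [1 / (expR u - 1)], and [expR u - 1] exceeds each single Taylor term. The order
    is left free: low orders serve small [u], high orders give decay. *)
Lemma expRN_ratio_le (R : realType) (u : R) n : 0 < u ->
  expR (- u) / (1 - expR (- u)) <= n.+1`!%:R / u ^+ n.+1.
Proof.
move=> u0; have := expR_ge1Dxn n (ltW u0); rewrite expRN.
have := expR_gt1 u; rewrite u0; set e := expR u => e1 h.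
have un : 0 < u ^+ n.+1 by rewrite exprn_gt0.
have fn : 0 < n.+1`!%:R :> R by rewrite ltr0n fact_gt0.
have -> : e^-1 / (1 - e^-1) = 1 / (e - 1) by field; lra.
rewrite ler_pdivrMr ?subr_gt0 // mulrAC ler_pdivlMr // mul1r.
by move: h; rewrite -lerBrDl ler_pdivrMr // mulrC.
Qed.

(* Interpolates between the regimes [i < Y] and [Y <= i] by a telescoping majorant. *)
Lemma decay_le (R : realFieldType) (A m u k : R) (Y i : nat) :
  0 < k -> k <= 1 -> 0 <= A -> 0 < u -> (0 < Y)%N ->
  ((Y <= i.+1)%N -> k * i.+1%:R / Y%:R <= u) ->
  m <= A -> m <= A / u ^+ 2 ->
  m <= 4 * A / k ^+ 2 * Y%:R ^+ 2 * ((i + Y)%:R^-1 - (i + Y).+1%:R^-1).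
Proof.
move=> k0 k1 A0 u0 Y0 uY mA mAu.
have Yr : 1 <= Y%:R :> R by rewrite ler1n.
have ir : 0 <= i%:R :> R by rewrite ler0n.
have -> : (i + Y)%:R^-1 - (i + Y).+1%:R^-1 =
    (i%:R + Y%:R)^-1 * (i%:R + Y%:R + 1)^-1 :> R.
  by rewrite -[(i + Y).+1]addn1 !natrD; field; lra.
set D := (i%:R + Y%:R) * (i%:R + Y%:R + 1) : R.
have D0 : 0 < D by rewrite /D; nra.
have -> : 4 * A / k ^+ 2 * Y%:R ^+ 2 * ((i%:R + Y%:R)^-1 * (i%:R + Y%:R + 1)^-1)
    = A * (4 * Y%:R ^+ 2 / k ^+ 2 / D) by rewrite /D; field; lra.
have k2 : 0 < k ^+ 2 by rewrite exprn_gt0.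
(* For [i + 1 <= Y] one has [D <= 4 * Y ^ 2]; otherwise [D <= 4 * (i + 1) ^ 2], and the lower bound
   on [u] pays for the larger [D]. *)
have [iY|iY] := leqP Y i.+1; last first.
  apply: (le_trans mA); rewrite -[leLHS]mulr1 ler_wpM2l // ler_pdivlMr // mul1r.
  rewrite ler_pdivlMr //.
  have {}iY : i%:R + 1 <= Y%:R :> R by rewrite natr1 ler_nat ltnW.
  apply: (@le_trans _ _ D); last by rewrite /D; nra.
  by rewrite -[leRHS]mulr1 ler_pM2l // expr_le1 // ltW.
apply: (le_trans mAu); rewrite ler_wpM2l // ler_pdivlMr // mulrC.
rewrite ler_pdivrMr ?exprn_gt0 //.
have {}uY := uY iY.
have {}iY : Y%:R <= i%:R + 1 :> R by rewrite natr1 ler_nat.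
have h : k * (i%:R + 1) <= u * Y%:R by move: uY; rewrite ler_pdivrMr ?natr1 //; lra.
have h2 : (k * (i%:R + 1)) ^+ 2 <= (u * Y%:R) ^+ 2.
  by rewrite lerXn2r // nnegrE; [nra|nra].
have -> : 4 * Y%:R ^+ 2 / k ^+ 2 * u ^+ 2 = 4 * (u * Y%:R) ^+ 2 / k ^+ 2 by field; lra.
rewrite ler_pdivlMr //; apply: (@le_trans _ _ (4 * (k * (i%:R + 1)) ^+ 2)); last first.
  by rewrite ler_pM2l.
have -> : 4 * (k * (i%:R + 1)) ^+ 2 = 4 * (i%:R + 1) ^+ 2 * k ^+ 2 by ring.
by rewrite ler_pM2r // /D; nra.
Qed.

Lemma sum_decay_le (R : realFieldType) (K : R) (M Y : nat) : 0 <= K -> (0 < Y)%N ->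
  \sum_(i < M) K * Y%:R ^+ 2 * ((i + Y)%:R^-1 - (i + Y).+1%:R^-1) <= K * Y%:R.
Proof.
move=> K0 Y0; rewrite -mulr_sumr.
have -> : \sum_(i < M) ((i + Y)%:R^-1 - (i + Y).+1%:R^-1) =
    Y%:R^-1 - (M + Y)%:R^-1 :> R.
  elim: M => [|M IH]; first by rewrite big_ord0 add0n subrr.
  by rewrite big_ord_recr /= IH addrA subrK.
have Yr : 0 < Y%:R :> R by rewrite ltr0n.
have h : 0 <= (M + Y)%:R^-1 :> R by rewrite invr_ge0 ler0n.
apply: (@le_trans _ _ (K * Y%:R ^+ 2 * Y%:R^-1)).
  by rewrite ler_wpM2l ?mulr_ge0 ?exprn_ge0 ?ler0n //; lra.
by rewrite le_eqVlt; apply/orP; left; apply/eqP; field; lra.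
Qed.

Section PolynomialGrowth.
Variables (R : realType) (a : nat -> nat) (d C0 : nat).
Hypotheses (d_gt0 : (0 < d)%N) (a_gt0 : forall i, (0 < a i)%N).
Hypothesis a_lo : forall i, (i.+1 ^ d <= C0 * a i)%N.
Hypothesis a_hi : forall i, (a i <= C0 * i.+1 ^ d)%N.

Lemma growth_const_gt0 : (0 < C0)%N.
Proof. by have := a_lo 0; rewrite exp1n; case: (C0) => //; rewrite mul0n. Qed.

Section Temperature.
Variables (M b Y : nat) (x k : R).
Hypotheses (Y_gt0 : (0 < Y)%N) (x_gt0 : 0 < x) (k_gt0 : 0 < k) (k_le1 : k <= 1).

Local Notation q := (expR (- x)).
Local Notation u i := ((a i)%:R * x).

Lemma tilt_gt0 : 0 < q. Proof. exact: expR_gt0. Qed.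
Lemma tilt_lt1 : q < 1. Proof. by rewrite expR_lt1 oppr_lt0. Qed.

Lemma energy_gt0 i : 0 < u i. Proof. by rewrite mulr_gt0 // ltr0n. Qed.

Lemma tilt_pow i : q ^+ a i = expR (- u i).
Proof. by rewrite -expRM_natl mulrN. Qed.

Let ge0 := geo_pos a b tilt_gt0.

Lemma mean_mult_le i n : mean_mult a b q i <= n.+1`!%:R / u i ^+ n.+1.
Proof.
apply: le_trans (expRN_ratio_le n (energy_gt0 i)).
rewrite /mean_mult ler_pdivrMr // -tilt_pow.
exact: geo_mean_le (qpow_gt0 a tilt_gt0 i) (qpow_lt1 tilt_gt0 tilt_lt1 a_gt0 i).
Qed.

(** With [v = Q / (1 - Q)] the moment is at most [2 * v * (1 + v)]. For [u i <= 1] the bound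
    [v <= 1 / u i] is used, for [u i > 1] the bounds [v <= 1] and [v <= 24 / u i ^+ 4]; hence
    [96 = 4 * 24]. *)
Lemma second_moment_le i : (\sum_(r < b.+1) r%:R ^+ 2 * (q ^+ a i) ^+ r) / geo a b q i <=
  96 / u i ^+ 2 /\
  (\sum_(r < b.+1) r%:R ^+ 2 * (q ^+ a i) ^+ r) / geo a b q i <=
  96 / u i ^+ 2 / u i ^+ 2.
Proof.
have Q0 := qpow_gt0 a tilt_gt0 i; have Q1 := qpow_lt1 tilt_gt0 tilt_lt1 a_gt0 i.
pose v := (q ^+ a i) / (1 - q ^+ a i).
have v0 : 0 < v by rewrite divr_gt0 // subr_gt0.
have v1 := expRN_ratio_le 0 (energy_gt0 i); have v4 := expRN_ratio_le 3 (energy_gt0 i).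
rewrite -tilt_pow -/v in v1 v4; move: v1 v4.
have -> : 4`!%:R = 24 :> R by []. rewrite !factS fact0 expr1.
have := energy_gt0 i; set t := u i => t0 v1 v4.
set S := _ / geo _ _ _ _.
have S_le : S <= 2 * v * (1 + v).
  rewrite /S ler_pdivrMr //; apply: (le_trans (geo_sqr_le b Q0 Q1)).
  rewrite -/(geo a b q i) ler_pM2r // le_eqVlt; apply/orP; left; apply/eqP.
  by rewrite /v; field; lra.
have ti : t * t^-1 = 1 by rewrite divff // gt_eqF.
have ti0 : 0 < t^-1 by rewrite invr_gt0.
move: v1 v4; rewrite -!exprVn; set s := t^-1 in ti ti0 *; rewrite mul1r => v1 v4.
have s2 : 0 < s ^+ 2 by rewrite exprn_gt0.
have [t1|t1] := leP t 1.
  have s1 : 1 <= s by nra.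
  have s21 : 1 <= s ^+ 2 by rewrite exprn_ege1.
  have h : S <= 96 * s ^+ 2 by apply: (le_trans S_le); nra.
  by split => //; apply: (le_trans h); rewrite ler_peMr //; nra.
have s1 : s <= 1 by nra.
have h4 : S <= 96 * s ^+ 2 * s ^+ 2.
  have v1' : v <= 1 by lra.
  have -> : 96 * s ^+ 2 * s ^+ 2 = 96 * s ^+ 4 by ring.
  by apply: (le_trans S_le); nra.
by split => //; apply: (le_trans h4); rewrite ler_piMr //; [nra|rewrite expr_le1 // ltW].
Qed.

Hypothesis u_lo : forall i, (Y <= i.+1)%N -> k * i.+1%:R / Y%:R <= u i.

Lemma mean_mass_le : mean_mass a M b q <= 24 / k ^+ 2 / x * Y%:R.
Proof.
apply: le_trans (sum_decay_le M _ Y_gt0); last first.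
  by rewrite !mulr_ge0 ?invr_ge0 ?exprn_ge0 // ltW.
apply: ler_sum => i _.
(* Here 6 is [3!]: the orders 1 and 3 of the bound on [mean_mult] supply the two regimes of
   [decay_le]. *)
have -> : 24 / k ^+ 2 / x = 4 * (6 / x) / k ^+ 2 by field; rewrite ?gt_eqF.
have ui := energy_gt0 i; have ai : 0 < (a i)%:R :> R by rewrite ltr0n.
apply: (decay_le (u := u i)) => //; first by rewrite divr_ge0 // ltW.
- exact: u_lo.
- have := mean_mult_le i 0; rewrite factS fact0 expr1 => h.
  have -> : 6 / x = (a i)%:R * (6 / u i) by field; rewrite ?gt_eqF.
  rewrite ler_pM2l //; apply: (le_trans h).
  by rewrite ler_pM2r ?invr_gt0 //; lra.
- have := mean_mult_le i 2; have -> : 3`!%:R = 6 :> R by []. move=> h.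
  have -> : 6 / x / u i ^+ 2 = (a i)%:R * (6 / u i ^+ 3) by field; rewrite ?gt_eqF.
  by rewrite ler_pM2l.
Qed.

Lemma variance_mass_le : \sum_(i < M) (a i)%:R ^+ 2 *
     ((\sum_(r < b.+1) r%:R ^+ 2 * (q ^+ a i) ^+ r) / geo a b q i) <=
  4 * 96 / k ^+ 2 / x ^+ 2 * Y%:R.
Proof.
apply: le_trans (sum_decay_le M _ Y_gt0); last first.
  by rewrite !mulr_ge0 ?invr_ge0 ?exprn_ge0 // ltW.
apply: ler_sum => i _.
have -> : 4 * 96 / k ^+ 2 / x ^+ 2 = 4 * (96 / x ^+ 2) / k ^+ 2 by field; rewrite ?gt_eqF.
have ui := energy_gt0 i; have ai : 0 < (a i)%:R :> R by rewrite ltr0n.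
have ai2 : 0 < (a i)%:R ^+ 2 :> R by rewrite exprn_gt0.
have [s1 s2] := second_moment_le i.
have E : 96 / x ^+ 2 = (a i)%:R ^+ 2 * (96 / u i ^+ 2) by field; rewrite ?gt_eqF.
apply: (decay_le (u := u i)) => //; first by rewrite divr_ge0 // exprn_ge0 // ltW.
- exact: u_lo.
- by rewrite E ler_pM2l.
- by rewrite E -[leRHS]mulrA ler_pM2l.
Qed.
End Temperature.
End PolynomialGrowth.

(** * Choice of the temperature and concentration *)

(** [s] is the integer part of [1 / (2 * u)]. For a part of energy [u] the weights [exp (- u * r)]
    stay above one half up to [r = s], so [s] is the scale of its typical multiplicity. *)
Lemma nat_scale (R : realType) (u : R) : 0 < u -> u <= 1 / 4 ->
  exists s : nat, [/\ s%:R * u <= 1 / 2, 1 / (4 * u) <= s%:R & (2 * s)%:R <= u^-1].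
Proof.
move=> u0 u4; have v0 : 0 <= 1 / (2 * u) by rewrite divr_ge0 // mulr_ge0 // ltW.
have /andP[s1 s2] := truncn_itv v0.
exists (Num.truncn (1 / (2 * u))); set s := (X in X%:R) in s1 s2 *.
have h1 : s%:R * (2 * u) <= 1 by rewrite -ler_pdivlMr //; lra.
have h2 : 1 < (s%:R + 1) * (2 * u) by rewrite -ltr_pdivrMr ?natr1 //; lra.
split; first by lra.
  by rewrite ler_pdivrMr; lra.
by rewrite -[leRHS]mul1r ler_pdivlMr // natrM; lra.
Qed.

(** * Lower bounds at high temperature *)

Section MeanLower.
Variables (R : realType) (a : nat -> nat) (d C0 : nat).
Hypotheses (d_gt0 : (0 < d)%N) (a_gt0 : forall i, (0 < a i)%N).
Hypothesis a_hi : forall i, (a i <= C0 * i.+1 ^ d)%N.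
Variables (M b Y : nat) (x : R).
Hypotheses (x_gt0 : 0 < x) (xb : x^-1 <= b.+1%:R).

Lemma energy_inv_le i : ((a i)%:R * x)^-1 <= b.+1%:R.
Proof.
apply: le_trans xb; rewrite lef_pV2 ?posrE ?mulr_gt0 ?ltr0n //.
by rewrite ler_peMl ?ler1n // ltW.
Qed.

Lemma expR_scale_ge i s : s%:R * ((a i)%:R * x) <= 1 / 2 ->
  1 / 2 <= (expR (- x) ^+ a i) ^+ s.
Proof.
move=> h; rewrite -exprM -expRM_natl natrM mulrN.
by apply: expRN_half_ge; rewrite mulrAC mulrA in h *; lra.
Qed.

Lemma geo_big i : (a i)%:R * x <= 1 / 4 ->
  1 / (8 * ((a i)%:R * x)) <= geo a b (expR (- x)) i.
Proof.
move=> u4; have u0 := energy_gt0 a_gt0 x_gt0 i.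
have [s [s1 s2 s3]] := nat_scale u0 u4.
have sb : (s <= b.+1)%N.
  rewrite -(ler_nat R); apply: le_trans (energy_inv_le i); apply: le_trans s3.
  by rewrite ler_nat leq_pmull.
have := geo_ge (qpow_gt0 a (tilt_gt0 x) i) (qpow_lt1 (tilt_gt0 x) (tilt_lt1 x_gt0) a_gt0 i) sb.
apply: le_trans; have := expR_scale_ge s1; set e := _ ^+ s => e2.
have -> : 1 / (8 * ((a i)%:R * x)) = 1 / (4 * ((a i)%:R * x)) * (1 / 2).
  by field; rewrite ?gt_eqF // ltr0n.
by apply: ler_pM => //; rewrite divr_ge0 // mulr_ge0 // ltW.
Qed.

Lemma mean_mult_ge i : (a i)%:R * x <= 1 / 4 ->
  1 / (16 * x) <= (a i)%:R * mean_mult a b (expR (- x)) i.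
Proof.
move=> u4; have u0 := energy_gt0 a_gt0 x_gt0 i.
have [s [s1 s2 s3]] := nat_scale u0 u4.
have sb : (2 * s <= b.+1)%N.
  by rewrite -(ler_nat R); apply: le_trans (energy_inv_le i).
have Q0 := qpow_gt0 a (tilt_gt0 x) i.
have Q1 := qpow_lt1 (tilt_gt0 x) (tilt_lt1 x_gt0) a_gt0 i.
have m := geo_mean_ge Q0 Q1 sb.
have a0 : 0 < (a i)%:R :> R by rewrite ltr0n.
have -> : 1 / (16 * x) = (a i)%:R * (1 / (4 * ((a i)%:R * x)) * (1 / 2) / 2).
  by field; rewrite ?gt_eqF.
rewrite ler_pM2l // /mean_mult ler_pdivlMr ?geo_pos ?tilt_gt0 //.
apply: le_trans m; rewrite ler_wpM2r ?(ltW (geo_pos _ _ (tilt_gt0 x) _)) //.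
rewrite ler_pM2r ?invr_gt0 //.
apply: ler_pM => //; last exact: expR_scale_ge.
by rewrite divr_ge0 // mulr_ge0 // ltW.
Qed.

(** Each of the first [Y] parts contributes at least [1 / (16 * x)], whatever its size, since the
    condition on [x] keeps their energies below [1 / 4]. *)
Lemma mean_mass_ge : (Y <= M)%N -> (C0 * Y ^ d)%:R * x <= 1 / 4 ->
  Y%:R / (16 * x) <= mean_mass a M b (expR (- x)).
Proof.
move=> YM Yx; rewrite /mean_mass.
rewrite -(big_mkord xpredT (fun i => (a i)%:R * mean_mult a b (expR (- x)) i)).
rewrite (big_cat_nat (leq0n Y) YM) //= ler_wpDr //.
  apply: sumr_ge0 => i _; rewrite mulr_ge0 ?ler0n // divr_ge0 //.
    by apply: sumr_ge0 => r _; rewrite mulr_ge0 ?ler0n ?exprn_ge0 ?expR_ge0.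
  by rewrite ltW // geo_pos // expR_gt0.
have -> : Y%:R / (16 * x) = \sum_(0 <= i < Y) (1 / (16 * x)).
  by rewrite sumr_const_nat subn0 -[RHS]mulr_natl mulrA mulr1.
apply: ler_sum_nat => i /andP[_ iY]; apply: mean_mult_ge.
apply: le_trans Yx; rewrite ler_wpM2r ?(ltW x_gt0) // ler_nat.
by apply: (leq_trans (a_hi i)); rewrite leq_mul2l leq_exp2r // iY orbT.
Qed.
End MeanLower.

(* After multiplication by the partition function, the equation on the mean is polynomial in
   the weight [r], so the intermediate value theorem for polynomials applies. *)
Lemma tilt_exists (R : rcfType) (a : nat -> nat) (M b : nat) (p q m : R) :
  (forall i, (0 < a i)%N) -> 0 < p -> p <= q ->
  mean_mass a M b p <= m -> m <= mean_mass a M b q ->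
  exists r, [/\ p <= r, r <= q & mean_mass a M b r = m].
Proof.
move=> a_gt0 p0 pq mp mq.
pose P : {poly R} := \sum_(w : conf M b) ((mass a w)%:R - m) *: 'X^(mass a w).
have PE (t : R) : 0 < t -> P.[t] = partition_function a M b t * (mean_mass a M b t - m).
  move=> t0; rewrite /P horner_sum mulrBr -(sum_weight_mass a M b t0).
  rewrite -(sum_weight a M b t) mulr_suml -sumrB; apply: eq_bigr => w _.
  by rewrite hornerZ hornerXn -mulrBr mulrC.
have q0 := lt_le_trans p0 pq.
have [|r /andP[pr rq] /rootP] := @poly_ivt R P p q pq.
  rewrite !PE // pmulr_rle0 ?partition_function_gt0 //.
  by rewrite pmulr_rge0 ?partition_function_gt0 // subr_le0 mp subr_ge0.
have r0 := lt_le_trans p0 pr.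
rewrite PE // => /eqP; rewrite mulf_eq0 gt_eqF ?partition_function_gt0 //= subr_eq0 => /eqP rm.
by exists r.
Qed.

Section Deviation.
Variables (R : realFieldType) (a : nat -> nat) (M b : nat) (q : R).
Hypothesis q0 : 0 < q.

(** Chebyshev's inequality: at most half of the total weight lies outside the window. *)
Lemma chebyshev_mass (v t : R) : 0 < t ->
  \sum_(i < M) (a i)%:R ^+ 2 *
     ((\sum_(r < b.+1) r%:R ^+ 2 * (q ^+ a i) ^+ r) / geo a b q i) <= v ->
  2 * v <= t ^+ 2 ->
  partition_function a M b q / 2 <=
  \sum_(w : conf M b | `|(mass a w)%:R - mean_mass a M b q| <= t) q ^+ mass a w.
Proof.
move=> t0 vle vt; set m := mean_mass _ _ _ _; pose P (w : conf M b) := `|(mass a w)%:R - m| <= t.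
have t2 : 0 < t ^+ 2 by rewrite exprn_gt0.
have Z0 := partition_function_gt0 a M b q0.
have := sum_weight a M b q; rewrite (bigID P) /=.
set A := (X in X + _); set B := (X in _ + X) => AB.
suff : B * t ^+ 2 <= partition_function a M b q * (t ^+ 2 / 2).
  move=> h; have : B <= partition_function a M b q / 2.
    by rewrite -(ler_pM2r t2) (le_trans h) // mulrA mulrAC.
  by rewrite -/A; lra.
apply: (@le_trans _ _ (partition_function a M b q * v)); last by rewrite ler_pM2l //; lra.
apply: (@le_trans _ _ (\sum_(w : conf M b) q ^+ mass a w * ((mass a w)%:R - m) ^+ 2)).
  rewrite [leRHS](bigID P) /= ler_wpDl //.
    by apply: sumr_ge0 => w _; rewrite mulr_ge0 ?sqr_ge0 // exprn_ge0 // ltW.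
  rewrite /B mulr_suml; apply: ler_sum => w; rewrite /P -ltNge => tw.
  rewrite ler_wpM2l ?exprn_ge0 ?(ltW q0) //.
  by rewrite -[leRHS]real_normK ?num_real // lerXn2r // ?nnegrE ?(ltW t0) // ltW.
apply: (le_trans (variance_le a M b q0)).
by rewrite ler_pM2l.
Qed.
End Deviation.

(** * Rarity of small multiplicities *)

Definition npart (a : nat -> nat) M b n : nat :=
  #|[set w : conf M b | mass a w == n]%SET|.

(** Each relation that cannot be applied to [w] will exhibit its own index of this kind, so this
    number controls the failures. *)
Definition low M b z B (w : conf M b) : nat :=
  #|[set i : 'I_M | (i < z)%N && (w i < B)%N]%SET|.

Lemma card_mass_le (a : nat -> nat) M b n N0 :
  (forall j, (j + N0 <= n)%N -> (npart a M b j <= npart a M b n)%N) ->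
  (#|[set w : conf M b | mass a w + N0 <= n]%SET| <= n.+1 * npart a M b n)%N.
Proof.
move=> mono; rewrite -sum1_card.
rewrite (partition_big (fun w : conf M b => inord (mass a w) : 'I_n.+1) xpredT) //=.
rewrite -[X in (_ <= X * _)%N]card_ord -sum_nat_const; apply: leq_sum => j _.
rewrite sum1dep_card; have [jn|jn] := boolP (j + N0 <= n)%N.
  apply: leq_trans (mono j jn); apply: subset_leq_card; apply/fintype.subsetP => w.
  rewrite !inE => /andP[wn /eqP <-]; rewrite inordK //.
  by rewrite ltnS (leq_trans _ wn) // leq_addr.
rewrite (_ : finset _ = finset.set0) ?cards0 //; apply/setP => w; rewrite !inE.
apply/negP => /andP[wn /eqP wj]; move/negP: jn; apply; rewrite -wj inordK //.
by rewrite ltnS (leq_trans _ wn) // leq_addr.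
Qed.

(** A vector in the window has weight at most [exp (- x * (m - t))], and its mass stays at least
    [N0] below [n], so monotonicity applies to it. Together with [chebyshev_mass] this bounds
    [npart] from below by the partition function. *)
Lemma window_weight_le_npart (R : realType) (a : nat -> nat) M b n N0 (x m t : R) :
  0 < x ->
  (forall j, (j + N0 <= n)%N -> (npart a M b j <= npart a M b n)%N) ->
  m + t + N0%:R <= n%:R ->
  \sum_(w : conf M b | `|(mass a w)%:R - m| <= t) expR (- x) ^+ mass a w <=
  (n.+1 * npart a M b n)%:R * expR (- (x * (m - t))).
Proof.
move=> x0 mono mt.
apply: (@le_trans _ _ (\sum_(w : conf M b | (mass a w + N0 <= n)%N) expR (- (x * (m - t))))).
  rewrite [leRHS](bigID (fun w : conf M b => `|(mass a w)%:R - m| <= t)) /=.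
  rewrite ler_wpDr ?sumr_ge0 //.
  rewrite (eq_bigl (fun w : conf M b => (mass a w + N0 <= n)%N && (`|(mass a w)%:R - m| <= t))).
    apply: ler_sum => w /andP[_]; rewrite ler_norml => /andP[h _].
    rewrite -expRM_natl mulrN ler_expR lerN2 mulrC ler_pM2r //; lra.
  move=> w; case: (boolP (_ <= t)); rewrite ?andbF ?andbT // ler_norml => /andP[_ h].
  by rewrite -(ler_nat R) natrD; apply/esym; lra.
rewrite sumr_const -[leLHS]mulr_natl ler_wpM2r ?expR_ge0 // ler_nat.
by apply: leq_trans (card_mass_le mono); rewrite cardsE.
Qed.

(** Exponential Markov inequality: each multiplicity below [B] at an index below [z] is rewarded by
    a factor [L]. This adds at most [L * B] to the geometric sum of that coordinate, hence at most
    doubles it. *)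
Lemma low_weight_le (R : realType) (a : nat -> nat) M b n z B th (L : nat) (q : R) :
  (forall i, (0 < a i)%N) -> 0 < q -> q < 1 -> (z <= M)%N -> (0 < L)%N ->
  (forall i, (i < z)%N -> (L * B)%:R <= geo a b q i) ->
  #|[set w : conf M b | (mass a w == n) && (th <= low z B w)%N]%SET|%:R
    * q ^+ n * (L ^ th)%:R <= 2 ^+ z * partition_function a M b q.
Proof.
move=> a_gt0 q0 q1 zM L0 LB.
pose F (i : 'I_M) (r : nat) : R := if (i < z)%N && (r < B)%N then L%:R else 1.
have F1 i r : 1 <= F i r by rewrite /F; case: ifP => _ //; rewrite ler1n.
have FL (w : conf M b) : \prod_i F i (w i) = (L ^ low z B w)%:R.
  rewrite -big_mkcond /= prodr_const natrX; congr (_ ^+ _).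
  by rewrite /low cardsE.
apply: (@le_trans _ _ (\sum_(w : conf M b) q ^+ mass a w * \prod_i F i (w i))).
  rewrite -sum1_card natr_sum 2!mulr_suml.
  rewrite [leRHS](bigID (fun w : conf M b => (mass a w == n) && (th <= low z B w)%N)) /=.
  rewrite ler_wpDr ?sumr_ge0 // => [w _|].
    by rewrite mulr_ge0 ?exprn_ge0 ?(ltW q0) // FL ler0n.
  rewrite (eq_bigl (fun w : conf M b => (mass a w == n) && (th <= low z B w)%N)).
    apply: ler_sum => w /andP[/eqP-> thw]; rewrite mul1r FL.
    by rewrite ler_wpM2l ?exprn_ge0 ?(ltW q0) // ler_nat leq_pexp2l.
  by move=> w; rewrite inE.
rewrite sum_weight_prod // /partition_function.
have -> : 2 ^+ z = \prod_(i < M) (if (i < z)%N then 2 else 1 : R).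
  rewrite -big_mkcond /= -(big_ord_widen M (fun=> 2 : R) zM) prodr_const.
  by rewrite card_ord.
rewrite -big_split /=; apply: ler_prod => i _; apply/andP; split.
  apply: sumr_ge0 => r _; rewrite mulr_ge0 ?exprn_ge0 ?(ltW q0) //.
  exact: le_trans (F1 _ _).
case: ifP => iz; last first.
  by rewrite mul1r /geo; apply: ler_sum => r _; rewrite /F iz mul1r.
have h : \sum_(r < b.+1) F i r * (q ^+ a i) ^+ r <=
   geo a b q i + L%:R * \sum_(r < b.+1 | (r < B)%N) (q ^+ a i) ^+ r.
  rewrite mulr_sumr /geo [X in _ + X]big_mkcond -big_split /=; apply: ler_sum => r _.
  rewrite /F iz /=; case: ifP => _; last by rewrite mul1r addr0.
  by rewrite lerDr !exprn_ge0 // ltW.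
apply: (le_trans h).
have hB := geo_head_le b (qpow_gt0 a q0 i) (qpow_lt1 q0 q1 a_gt0 i) B.
have : L%:R * \sum_(r < b.+1 | (r < B)%N) (q ^+ a i) ^+ r <= geo a b q i.
  by apply: le_trans (LB i iz); rewrite natrM ler_pM2l // ltr0n.
lra.
Qed.

(** This amounts to [e <= 4], which is the square of [exp (- 1 / 2) >= 1 / 2]. *)
Lemma expRN_nat_ge (R : realType) z : (4 ^+ z)^-1 <= expR (- z%:R) :> R.
Proof.
rewrite expRN lef_pV2 ?posrE ?expR_gt0 ?exprn_gt0 // -[z%:R]mulr1 expRM_natl.
rewrite lerXn2r ?nnegrE ?expR_ge0 //.
have := @expRN_half_ge R (1 / 2) (lexx _); rewrite expRN.
have := expR_gt0 (1 / 2 : R) => e0; have -> : expR 1 = expR (1 / 2) ^+ 2 :> R.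
  by rewrite -expRM_natl; congr expR; lra.
set e := expR _ in e0 *; rewrite -lef_pV2 ?posrE ?invr_gt0 // invrK => h; nra.
Qed.

Section Rarity.
Variables (R : realType) (a : nat -> nat) (d C0 : nat).
Hypotheses (d_gt0 : (0 < d)%N) (a_gt0 : forall i, (0 < a i)%N).
Hypothesis a_lo : forall i, (i.+1 ^ d <= C0 * a i)%N.
Hypothesis a_hi : forall i, (a i <= C0 * i.+1 ^ d)%N.

(** The ratio [t = (i + 1) / Y >= 1] satisfies [t <= t ^ d], so growth of degree [d] implies the
    linear lower bound that [decay_le] asks for. *)
Lemma energy_scale_ge (Y i : nat) (x k beta : R) : (0 < Y)%N -> 0 < x -> 0 <= k ->
  k * C0%:R <= beta -> beta / Y%:R ^+ d <= x -> (Y <= i.+1)%N ->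
  k * i.+1%:R / Y%:R <= (a i)%:R * x.
Proof.
move=> Y0 x0 k0 kb bx Yi.
have C0p : 0 < C0%:R :> R by rewrite ltr0n; exact: growth_const_gt0 a_lo.
have Yr : 0 < Y%:R :> R by rewrite ltr0n.
have Yd : 0 < Y%:R ^+ d :> R by rewrite exprn_gt0.
set t : R := i.+1%:R / Y%:R.
have t1 : 1 <= t by rewrite ler_pdivlMr // mul1r ler_nat.
have td : t <= t ^+ d by rewrite -[leLHS]expr1 ler_weXn2l.
have h1 : i.+1%:R ^+ d <= C0%:R * (a i)%:R :> R by rewrite -natrX -natrM ler_nat.
rewrite -mulrA -/t; apply: (@le_trans _ _ (k * t ^+ d)); first by rewrite ler_wpM2l.
have -> : t ^+ d = i.+1%:R ^+ d / Y%:R ^+ d by rewrite /t expr_div_n.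
rewrite mulrA ler_pdivrMr //.
apply: (@le_trans _ _ (k * (C0%:R * (a i)%:R))); first by rewrite ler_wpM2l.
rewrite mulrA [k * _ * _]mulrC -mulrA ler_wpM2l ?ler0n //.
by apply: (le_trans kb); rewrite -ler_pdivrMr.
Qed.

(* [E] fixes the zone [i < Y %/ E]: there [a i * x] is so small that a multiplicity below [B]
   costs a factor [1 / 8 ^ rho], which beats both the [2 ^ z] choices of the small
   multiplicities and the loss [exp (3 / 2 * eps * x * n)] from centering at [(1 - eps) n]. *)
Lemma low_rare (B rho N0 : nat) : (0 < B)%N ->
  exists E Y0 K : nat, [/\ (0 < E)%N, (E <= Y0)%N & forall n Y M b th : nat,
   (Y0 <= Y)%N -> (Y ^ d.+1 <= n)%N -> (n <= Y.+1 ^ d.+1)%N ->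
   (Y <= M)%N -> (K * n <= b)%N ->
   (forall j, (j + N0 <= n)%N -> (npart a M b j <= npart a M b n)%N) ->
   (Y %/ E <= rho * th)%N ->
   #|[set w : conf M b | (mass a w == n) && (th <= low (Y %/ E) B w)%N]%SET|%:R
   <= 2 * (n.+1 * npart a M b n)%:R * expR (- (Y%:R / (4 * E%:R))) :> R].
Proof.
move=> B0; have C00 := growth_const_gt0 a_lo.
have C0p : 1 <= C0%:R :> R by rewrite ler1n.
have C0pos : 0 < C0%:R :> R by rewrite ltr0n.
(* [n <= (Y + 1) ^ d.+1] entails [n <= T * Y ^ d.+1]. *)
have [T TE] : exists v : R, v = 2 ^+ d.+1 by eexists.
have T1 : 1 <= T by rewrite TE exprn_ege1 // ler1n.
have [L LE] : exists v, v = (8 ^ rho)%N by eexists.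
have L0 : (0 < L)%N by rewrite LE expn_gt0.
(* This is [8 * L * B * C0 * beta1]: indices below [Y / E] then have energy at most
   [1 / (8 * L * B)], so that their geometric sums reach [L * B]. *)
have [E EE] : exists v, v = (8 * L * B * C0 * (48 * C0))%N by eexists.
have E0 : (0 < E)%N by rewrite EE !muln_gt0 L0 B0 C00.
have Er : 1 <= E%:R :> R by rewrite ler1n.
have Er0 : 0 < E%:R :> R by rewrite ltr0n.
have T0 : 0 < T by apply: lt_le_trans T1.
(* Bracket for the temperature: at [x = beta0 / Y ^ d] the mean mass is at least
   [Y / (16 * x) = T * C0 * Y ^ d.+1 >= n]; at [x = beta1 / Y ^ d] it is at most
   [24 * Y / x <= n / 2]. *)
have [beta0 beta0E] : exists v : R, v = (16 * T * C0%:R)^-1 by eexists.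
have [beta1 beta1E] : exists v : R, v = 48 * C0%:R by eexists.
have b0 : 0 < beta0 by rewrite beta0E invr_gt0; nra.
have b0T : beta0 * (16 * T * C0%:R) = 1 by rewrite beta0E mulVf // gt_eqF; nra.
have ErE : E%:R = 8 * (L * B)%:R * (C0%:R * beta1) :> R.
  by rewrite EE beta1E !natrM; ring.
clear EE.
have b0I : beta0^-1 = 16 * T * C0%:R by rewrite beta0E invrK.
clear beta0E.
have [k kE] : exists v, v = beta0 / C0%:R by eexists.
have k0 : 0 < k by rewrite kE divr_gt0 //; lra.
have kC : k * C0%:R = beta0 by rewrite kE divfK // gt_eqF; lra.
clear kE.
have k1 : k <= 1.
  have TC : 1 <= T * C0%:R by nra.
  have : beta0 <= 1 by nra.
  by nra.
(* As [x * n <= beta1 * T * Y], the loss [exp (3 / 2 * eps * x * n)] is at most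
   [exp (3 / 16 * Y / E)], against a gain [exp (- z)] with [z >= Y / (2 * E)]. *)
have [eps epsE] : exists v : R, v = (8 * E%:R * beta1 * T)^-1 by eexists.
have b1 : 0 < beta1 by rewrite beta1E; lra.
have D0 : 0 < 8 * E%:R * beta1 * T by rewrite !mulr_gt0.
have e0 : 0 < eps by rewrite epsE invr_gt0.
have eD : eps * (8 * E%:R * beta1 * T) = 1 by rewrite epsE mulVf // gt_eqF.
have eB : eps * beta1 * T = (8 * E%:R)^-1 by rewrite epsE; field; rewrite ?gt_eqF.
clear epsE.
have e2 : eps <= 1 / 2.
  have : 2 <= 8 * E%:R * beta1 * T.
    have : 1 <= E%:R * beta1 by rewrite beta1E; nra.
    by nra.
  by nra.
(* [Y1] makes twice the variance bound at most [(eps * n / 2) ^ 2]; [Y2] makes the shift [N0] at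
   most [eps * n / 2]. *)
have [Y1 Y1E] : exists v : R, v = 32 * 96 / (k ^+ 2 * beta0 ^+ 2 * eps ^+ 2) by eexists.
have [Y2 Y2E] : exists v : R, v = 2 * N0%:R / eps by eexists.
have [Y0 Y0E] : exists v, v = (E + (Num.truncn Y1).+1 + (Num.truncn Y2).+1)%N by eexists.
(* The last witness is [1 / beta0]; as [Y ^ d <= n], the cap [b] reaches [1 / x] throughout the
   bracket. *)
exists E, Y0, (16 * 2 ^ d.+1 * C0)%N; split => //; first by rewrite Y0E -addnA leq_addr.
move=> n Y M b th Y0Y Yn nY YM Kb mono zth.
have EY : (E <= Y)%N by rewrite (leq_trans _ Y0Y) // Y0E -addnA leq_addr.
have Y_gt0 : (0 < Y)%N by apply: leq_trans EY.
have YB (u : R) c : (c + (Num.truncn u).+1 <= Y0)%N -> u <= Y%:R.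
  move=> h; apply: ltW; apply: (lt_le_trans (truncnS_gt u)); rewrite ler_nat.
  by apply: leq_trans Y0Y; apply: leq_trans h; rewrite leq_addl.
have Y1Y : Y1 <= Y%:R by apply: (YB _ E); rewrite Y0E leq_addr.
have Y2Y : Y2 <= Y%:R by apply: (YB _ 0%N); rewrite Y0E add0n leq_addl.
clear YB Y0E.
have YD : 32 * 96 <= Y%:R * (k ^+ 2 * beta0 ^+ 2 * eps ^+ 2).
  by rewrite -ler_pdivrMr -?Y1E // !mulr_gt0 // ?exprn_gt0.
have YN : 2 * N0%:R <= Y%:R * eps by rewrite -ler_pdivrMr // -Y2E.
clear Y1E Y2E Y1Y Y2Y Y1 Y2.
have Yr : 1 <= Y%:R :> R by rewrite ler1n.
have [Yd YdE] : exists v : R, v = Y%:R ^+ d by eexists.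
have Yd0 : 0 < Yd by rewrite YdE exprn_gt0 // ltr0n.
have YYd : 1 <= Yd by rewrite YdE exprn_ege1.
have [nr nrE] : exists v : R, v = n%:R by eexists.
have nlo : Yd * Y%:R <= nr by rewrite YdE nrE -exprSr -natrX ler_nat.
have nhi : nr <= T * (Yd * Y%:R).
  apply: (@le_trans _ _ (Y.+1%:R ^+ d.+1)); first by rewrite nrE -natrX ler_nat.
  rewrite TE YdE -exprSr -exprMn lerXn2r ?nnegrE ?mulr_ge0 //; lra.
have nY1 : Y%:R <= nr by nra.
have [x0 x0E] : exists v, v = beta0 / Yd by eexists.
have [x1 x1E] : exists v, v = beta1 / Yd by eexists.
have x0p : 0 < x0 by rewrite x0E divr_gt0.
have x1p : 0 < x1 by rewrite x1E divr_gt0.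
have x0Yd : x0 * Yd = beta0 by rewrite x0E divfK // gt_eqF.
have x1Yd : x1 * Yd = beta1 by rewrite x1E divfK // gt_eqF.
have b01 : beta0 <= beta1.
  by rewrite beta1E -[leLHS]kC ler_pM2r //; apply: le_trans k1 _; rewrite ler1n.
have x01 : x0 <= x1 by rewrite x0E x1E ler_pM2r ?invr_gt0.
have x0b : x0^-1 <= b.+1%:R.
  apply: (@le_trans _ _ (16 * 2 ^ d.+1 * C0 * n)%:R); last first.
    by rewrite ler_nat (leq_trans Kb).
  have c0 : 0 < 16 * T * C0%:R by rewrite !mulr_gt0.
  rewrite x0E invf_div b0I !natrM natrX -TE -nrE mulrC ler_pM2l //.
  by apply: le_trans nlo; rewrite ler_peMr // ltW.
have [m mE] : exists v, v = (1 - eps) * nr by eexists.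
have mean1 : mean_mass a M b (expR (- x1)) <= m.
  apply: le_trans (mean_mass_le a_gt0 M b Y_gt0 x1p ltr01 (lexx 1) _) _.
    move=> i Yi; apply: (energy_scale_ge (beta := beta1)) => //.
      by rewrite mul1r beta1E ler_peMl ?ler0n ?ler1n.
    by rewrite -YdE -x1E.
  apply: (@le_trans _ _ (nr / 2)); last by rewrite mE; nra.
  rewrite expr1n divr1 x1E invf_div mulrA.
  rewrite mulrAC ler_pdivrMr //; rewrite beta1E; nra.
have mean0 : m <= mean_mass a M b (expR (- x0)).
  apply: le_trans _ (mean_mass_ge d_gt0 a_gt0 a_hi x0p x0b YM _).
    rewrite ler_pdivlMr; last by lra.
    rewrite x0E !mulrA ler_pdivrMr //.
    have : beta0 * 16 * T <= 1.
      by rewrite -[leRHS]b0T -[leLHS]mulrA ler_pM2l // ler_peMr ?mulr_ge0 ?(ltW T0).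
    rewrite mE => h; have : (1 - eps) * nr <= T * (Yd * Y%:R).
      by apply: le_trans nhi; rewrite ler_piMl ?nrE ?ler0n // gerBl ltW.
    move=> h2; apply: (@le_trans _ _ (T * (Yd * Y%:R) * (16 * beta0))).
      by rewrite -[leLHS]mulrA ler_pM2r ?mulr_gt0.
    have -> : T * (Yd * Y%:R) * (16 * beta0) = beta0 * 16 * T * (Y%:R * Yd) by ring.
    by rewrite ler_piMl // mulr_ge0 // ltW.
  rewrite natrM natrX -YdE.
  have -> : C0%:R * Yd * x0 = C0%:R * beta0 by rewrite -x0Yd; ring.
  by nra.
have p01 : expR (- x1) <= expR (- x0) by rewrite ler_expR lerN2.
have [r [rp rq rm]] := tilt_exists a_gt0 (expR_gt0 _) p01 mean1 mean0.
have r0 : 0 < r by apply: lt_le_trans rp; apply: expR_gt0.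
have [x xE] : exists v, v = - ln r by eexists.
have rx : r = expR (- x) by rewrite xE opprK lnK.
rewrite {}rx in rp rq rm r0; rewrite ler_expR lerN2 in rp; rewrite ler_expR lerN2 in rq.
have xp : 0 < x by apply: lt_le_trans rq.
have q1 := tilt_lt1 xp.
have xb : x^-1 <= b.+1%:R by apply: le_trans x0b; rewrite lef_pV2.
have [P PE] : exists v : R, v = (n.+1 * npart a M b n)%:R by eexists.
have P0 : 0 <= P by rewrite PE ler0n.
have [t tE] : exists v, v = eps * nr / 2 by eexists.
have nr0 : 0 < nr by apply: lt_le_trans nY1; rewrite ltr0n.
have t0 : 0 < t by rewrite tE divr_gt0 // mulr_gt0.
clear eD D0 b0T b01 mean1 mean0 p01.
have lower : partition_function a M b (expR (- x)) / 2 <= P * expR (- (x * (m - t))).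
  have := @chebyshev_mass _ a M b _ (expR_gt0 (- x)) (4 * 96 / k ^+ 2 / x ^+ 2 * Y%:R) t t0.
  rewrite rm; move=> cheb; apply: le_trans (cheb _ _) _; last 1 first.
  - rewrite PE; apply: (window_weight_le_npart (N0 := N0)) => //.
    have : Y%:R * eps <= nr * eps by rewrite ler_pM2r.
    by rewrite -nrE mE tE ; lra.
  - apply: variance_mass_le => // i Yi.
    by apply: (energy_scale_ge (beta := beta0)) => //; rewrite ?kC -?YdE -?x0E // ltW.
  have k2 : 0 < k ^+ 2 by rewrite exprn_gt0.
  have x2 : x0 ^+ 2 <= x ^+ 2 by rewrite lerXn2r // nnegrE ltW.
  have x02 : 0 < x0 ^+ 2 by rewrite exprn_gt0.
  apply: (@le_trans _ _ (2 * (4 * 96 / k ^+ 2 / x0 ^+ 2 * Y%:R))).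
    rewrite ler_pM2l // ler_pM2r ?ltr0n //.
    by rewrite ler_pM2l ?divr_gt0 ?mulr_gt0 // lef_pV2 ?posrE // (lt_le_trans x02).
  apply: (@le_trans _ _ (eps ^+ 2 * (Yd * Y%:R) ^+ 2 / 4)); last first.
    have -> : t ^+ 2 = eps ^+ 2 * nr ^+ 2 / 4 by rewrite tE; field.
    rewrite ler_pM2r // ler_pM2l ?exprn_gt0 // lerXn2r ?nnegrE //.
      by rewrite mulr_ge0 ?ler0n // ltW.
    exact: ltW.
  have -> : 2 * (4 * 96 / k ^+ 2 / x0 ^+ 2 * Y%:R) = 32 * 96 * (Y%:R / 4 / k ^+ 2 / x0 ^+ 2).
    by field; rewrite ?gt_eqF.
  have c0 : 0 < Y%:R / 4 / k ^+ 2 / x0 ^+ 2 by rewrite !divr_gt0 // ltr0n.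
  apply: (@le_trans _ _ (Y%:R * (k ^+ 2 * beta0 ^+ 2 * eps ^+ 2) *
    (Y%:R / 4 / k ^+ 2 / x0 ^+ 2))); first by rewrite ler_pM2r.
  rewrite -x0Yd le_eqVlt; apply/orP; left; apply/eqP.
  by field; rewrite ?gt_eqF.
have [z zE] : exists v, v = (Y %/ E)%N by eexists.
have z1 : (1 <= z)%N by rewrite zE divn_gt0.
have zEY : (z * E <= Y)%N by rewrite zE leq_trunc_div.
have zY : (z <= Y)%N by rewrite zE leq_div.
have Yz : Y%:R <= 2 * z%:R * E%:R :> R.
  rewrite -!natrM ler_nat; apply: leq_trans (ltnW (ltn_ceil Y E0)) _.
  by rewrite -zE leq_mul2r -addn1 mul2n -addnn leq_add2l z1 orbT.
have geoLB i : (i < z)%N -> (L * B)%:R <= geo a b (expR (- x)) i.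
  move=> iz; have aE : (a i)%:R * x * E%:R <= C0%:R * beta1.
    apply: (@le_trans _ _ ((C0 * z ^ d)%:R * x1 * E%:R)).
      rewrite ler_pM2r //.
      apply: ler_pM => //; first by rewrite ltW.
      rewrite ler_nat; apply: (leq_trans (a_hi i)).
      by rewrite leq_mul2l leq_exp2r // iz orbT.
    have zdE : (z ^ d * E)%:R <= Yd.
      rewrite YdE -natrX ler_nat; apply: (@leq_trans ((z * E) ^ d)).
        rewrite expnMn leq_mul2l; apply/orP; right.
        by rewrite -[leqLHS]expn1 leq_pexp2l.
      by rewrite leq_exp2r.
    rewrite natrM -x1Yd -[leLHS]mulrA -[leLHS]mulrA ler_pM2l //.
    by rewrite mulrCA ler_pM2l // -natrM.
  have LB1 : 1 <= (L * B)%:R :> R by rewrite ler1n muln_gt0 L0.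
  have u0 := energy_gt0 a_gt0 xp i.
  have uL : 8 * (L * B)%:R * ((a i)%:R * x) <= 1.
    have Cb : 0 < C0%:R * beta1 by rewrite mulr_gt0.
    rewrite -(ler_pM2r Cb) mul1r; apply: le_trans aE.
    by rewrite ErE le_eqVlt; apply/orP; left; apply/eqP; ring.
  apply: le_trans (geo_big a_gt0 xp xb _).
    rewrite ler_pdivlMr ?mulr_gt0 ?ltr0n //; apply: le_trans uL.
    by rewrite le_eqVlt; apply/orP; left; apply/eqP; ring.
  rewrite ler_pdivlMr //; apply: le_trans uL; rewrite mulrC -[leLHS]mul1r mulrA.
  rewrite ler_pM2r // mul1r; lra.
have := low_weight_le n th a_gt0 (expR_gt0 (- x)) q1 (leq_trans zY YM) L0 geoLB.
rewrite -zE; set Nb := (X in X * _ * _).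
rewrite -expRM_natl mulrN -nrE => up.
have Nb0 : 0 <= Nb by rewrite ler0n.
have Lth : 8 ^+ z <= (L ^ th)%:R :> R.
  by rewrite -natrX ler_nat LE -expnM leq_pexp2l // zE.
have z80 : 0 < 8 ^+ z :> R by rewrite exprn_gt0.
have up2 : Nb * expR (- (nr * x)) * 8 ^+ z <= 2 ^+ z * (2 * P * expR (- (x * (m - t)))).
  apply: (@le_trans _ _ (Nb * expR (- (nr * x)) * (L ^ th)%:R)).
    by rewrite ler_wpM2l // mulr_ge0 // expR_ge0.
  by apply: (le_trans up); rewrite ler_pM2l ?exprn_gt0 // -mulrA -ler_pdivrMl // mulrC.
have e1 : 0 < expR (- (nr * x)) by apply: expR_gt0.
(* The exponent is [x * (n - m + t)] with [n - m = eps * n] and [t = eps * n / 2]. *)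
have up3 : Nb <= 2 * P * ((4 ^+ z)^-1 * expR (x * (eps * nr * (3 / 2)))).
  rewrite -(ler_pM2r z80) -(ler_pM2r e1) mulrAC; apply: (le_trans up2).
  have -> : x * (eps * nr * (3 / 2)) = nr * x - x * (m - t) by rewrite mE tE; field.
  have enx : expR (nr * x) * expR (- (nr * x)) = 1 by rewrite -expRD subrr expR0.
  have e4 : (4 ^+ z)^-1 * 4 ^+ z = 1 :> R by rewrite mulVf // gt_eqF // exprn_gt0.
  rewrite expRD; have -> : 8 ^+ z = 2 ^+ z * 4 ^+ z :> R.
    by rewrite -exprMn; congr (_ ^+ _); ring.
  rewrite le_eqVlt; apply/orP; left; apply/eqP; symmetry.
  move: enx e4; set A := expR (nr * x); set A' := expR (- (nr * x)).
  set F := _^-1; set G := 4 ^+ z => enx e4; rewrite -[RHS]mulr1 -[X in _ = _ * X]enx.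
  by rewrite -[RHS]mulr1 -[X in _ = _ * X]e4; ring.
apply: (le_trans up3); rewrite -PE ler_wpM2l ?mulr_ge0 //.
apply: (@le_trans _ _ (expR (- z%:R) * expR (x * (eps * nr * (3 / 2))))).
  by rewrite ler_wpM2r ?expR_ge0 // expRN_nat_ge.
rewrite -expRD ler_expR.
have xn : x * nr <= beta1 * T * Y%:R.
  apply: (@le_trans _ _ (x1 * (T * (Yd * Y%:R)))); first by apply: ler_pM => //; apply: ltW.
  by rewrite -x1Yd le_eqVlt; apply/orP; left; apply/eqP; ring.
have exn : x * (eps * nr * (3 / 2)) <= 3 / 16 * (Y%:R / E%:R).
  have -> : x * (eps * nr * (3 / 2)) = 3 / 2 * eps * (x * nr) by ring.
  apply: (@le_trans _ _ (3 / 2 * eps * (beta1 * T * Y%:R))).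
    by rewrite ler_pM2l // mulr_gt0.
  have -> : 3 / 2 * eps * (beta1 * T * Y%:R) = 3 / 2 * (eps * beta1 * T) * Y%:R by ring.
  by rewrite eB le_eqVlt; apply/orP; left; apply/eqP; field; rewrite ?gt_eqF.
have YE : Y%:R / E%:R <= 2 * z%:R :> R by rewrite ler_pdivrMr.
have -> : Y%:R / (4 * E%:R) = (Y%:R / E%:R) / 4 :> R by field; rewrite ?gt_eqF.
have : 0 <= Y%:R / E%:R :> R by rewrite divr_ge0.
by lra.
Qed.
End Rarity.

(** * Trigonometric sums and switching involutions *)

Lemma sin_natmul_le (R : realType) (n : nat) (x : R) : `|sin (n%:R * x)| <= n%:R * `|sin x|.
Proof.
elim: n => [|n IH]; first by rewrite !mul0r sin0 normr0.
rewrite -natr1 !mulrDl !mul1r sinD; apply: (le_trans (ler_normD _ _)).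
rewrite !normrM; apply: lerD.
  by apply: le_trans IH; rewrite ler_piMr // cos_max.
by rewrite ler_piMl // cos_max.
Qed.

(** At [x = pi / (2 * k)] the inequality [|sin (k * x)| <= k * |sin x|] reads [1 <= k * sin x], and
    the sine increases from there to [pi / 2]. *)
Lemma sin_pi_frac_ge (R : realType) (r k : nat) : (0 < r)%N -> (2 * r <= k)%N ->
  k%:R^-1 <= sin (pi * r%:R / k%:R) :> R.
Proof.
move=> r0 rk; have k0 : (0 < k)%N by lia.
have kr : 0 < k%:R :> R by rewrite ltr0n.
have p0 : 0 < pi :> R := pi_gt0 R.
set x : R := pi / (2 * k%:R); set v := pi * r%:R / k%:R.
have x0 : 0 < x by rewrite divr_gt0 // mulr_gt0.
have xv : x <= v.
  rewrite /v -mulrA ler_pM2l // invfM ler_pM2r ?invr_gt0 //.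
  by apply: (@le_trans _ _ 1); [lra|rewrite ler1n].
have vp : v <= pi / 2.
  rewrite /v -mulrA ler_pM2l // ler_pdivrMr // mulrC.
  have : (2 * r)%:R <= k%:R :> R by rewrite ler_nat.
  by rewrite natrM; lra.
have sx : k%:R^-1 <= sin x.
  rewrite -[leLHS]mul1r ler_pdivrMr // mulrC.
  have := sin_natmul_le k x; rewrite [in sin (k%:R * x)]/x.
  have -> : k%:R * (pi / (2 * k%:R)) = pi / 2 :> R by field; rewrite ?gt_eqF.
  rewrite sin_pihalf normr1 ger0_norm // sin_ge0_pi // ltW //=.
  by apply: le_trans xv _; apply: le_trans vp _; lra.
apply: (le_trans sx); rewrite le_eqVlt; move: xv; rewrite le_eqVlt => /orP[/eqP->|xv].
  by rewrite eqxx.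
by rewrite ltr_sin ?xv ?orbT // in_itv /=; apply/andP; split; lra.
Qed.

Lemma norm_sin_pi_frac_ge (R : realType) (m k : nat) : (0 < k)%N -> ~~ (k %| m)%N ->
  k%:R^-1 <= `|sin (pi * m%:R / k%:R)| :> R.
Proof.
move=> k0 km; have kr : k%:R != 0 :> R by rewrite pnatr_eq0 -lt0n.
have -> : `|sin (pi * m%:R / k%:R)| = `|sin (pi * (m %% k)%:R / k%:R)| :> R.
  have -> : pi * m%:R / k%:R = pi * (m %% k)%:R / k%:R + pi *+ (m %/ k) :> R.
    by rewrite {1}(divn_eq m k) natrD natrM -mulr_natr; field.
  by rewrite (alternatingn (@sinDpi R)) normrM normrX normrN1 expr1n mul1r.
have r0 : (0 < m %% k)%N by rewrite lt0n.
have rk : (m %% k < k)%N by rewrite ltn_mod.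
have [h|h] := leqP (2 * (m %% k)) k.
  by apply: le_trans (sin_pi_frac_ge R r0 h) (ler_norm _).
have -> : pi * (m %% k)%:R / k%:R = - (pi * (k - m %% k)%:R / k%:R) + pi :> R.
  by rewrite natrB ?(ltnW rk) //; field.
rewrite sinDpi sinN opprK; apply: le_trans (sin_pi_frac_ge R _ _) (ler_norm _); lia.
Qed.

(** [cos ^ 2 = 1 - sin ^ 2 <= 1 - 1 / k ^ 2 <= exp (- 1 / k ^ 2)]. *)
Lemma norm_cos_pi_frac_le (R : realType) (m k : nat) : (0 < k)%N -> ~~ (k %| m)%N ->
  `|cos (pi * m%:R / k%:R)| <= expR (- (2 * k%:R ^+ 2)^-1) :> R.
Proof.
move=> k0 km; have kr : 0 < k%:R :> R by rewrite ltr0n.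
have h := norm_sin_pi_frac_ge R k0 km.
rewrite -(@ler_pXn2r _ 2) ?nnegrE ?expR_ge0 // real_normK ?num_real //.
rewrite cos2sin2 -expRM_natl.
have -> : 2%:R * - (2 * k%:R ^+ 2)^-1 = - (k%:R ^+ 2)^-1 :> R by field; rewrite ?gt_eqF.
apply: le_trans (expR_ge1Dx _); rewrite lerD2l lerN2.
rewrite -[leRHS]real_normK ?num_real // -exprVn lerXn2r // nnegrE ?invr_ge0 ?ler0n //.
Qed.

(** Orthogonality of characters modulo [k] in real form. When [k] does not divide [m],
    multiplication by [2 * sin u] makes the sum telescope, and [2 * k * u = 2 * pi * m] closes it
    up. *)
Lemma sum_cos_orth (R : realType) (k m : nat) : (0 < k)%N ->
  \sum_(j < k) cos (2 * (pi * (j * m)%:R / k%:R)) = (if (k %| m)%N then k%:R else 0) :> R.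
Proof.
move=> k0; have kr : k%:R != 0 :> R by rewrite pnatr_eq0 -lt0n.
case: ifP => km.
  rewrite -[X in _ = X%:R]card_ord -sumr_const; apply: eq_bigr => j _.
  have -> : 2 * (pi * (j * m)%:R / k%:R) = 0 + (pi *+ 2) *+ (j * (m %/ k)) :> R.
    by rewrite -{1}(divnK km) -[in RHS]mulrnA -mulr_natr !natrM; field.
  by rewrite (periodicn (@cosD2pi R)) cos0.
set u : R := pi * m%:R / k%:R.
have u0 : sin u != 0.
  rewrite -normr_gt0; apply: lt_le_trans (norm_sin_pi_frac_ge R k0 (negbT km)).
  by rewrite invr_gt0 ltr0n.
apply: (mulfI u0); rewrite mulr0; apply: (@mulfI _ 2); first by rewrite pnatr_eq0.
rewrite mulr0 !mulr_sumr.
have E (j : nat) : 2 * (sin u * cos (2 * (pi * (j * m)%:R / k%:R))) =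
    sin ((2 * j%:R + 1) * u) - sin ((2 * j%:R - 1) * u).
  have -> : 2 * (pi * (j * m)%:R / k%:R) = 2 * j%:R * u by rewrite /u natrM; field.
  have -> : (2 * j%:R + 1) * u = 2 * j%:R * u + u by ring.
  have -> : (2 * j%:R - 1) * u = 2 * j%:R * u - u by ring.
  by rewrite (sinD _ u) (sinB _ u); ring.
under eq_bigr do rewrite E.
have tel : forall l, \sum_(j < l) (sin ((2 * j%:R + 1) * u) - sin ((2 * j%:R - 1) * u)) =
    sin ((2 * l%:R - 1) * u) + sin u.
  elim=> [|l IH]; first by rewrite big_ord0 mulr0 sub0r mulN1r sinN addNr.
  rewrite big_ord_recr /= IH -(natr1 l).
  have -> : (2 * (l%:R + 1) - 1) * u = (2 * l%:R + 1) * u by ring.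
  by ring.
rewrite tel.
have -> : (2 * k%:R - 1) * u = - u + (pi *+ 2) *+ m.
  by rewrite -[X in _ = _ + X]mulr_natr -(mulr_natr pi 2) /u; field.
by rewrite (periodicn (@sinD2pi R)) sinN addNr.
Qed.

(* Averaging over an involution which shifts the phase by [delta] multiplies the
   cosine by [cos (delta / 2)] and adds [delta / 2] to its phase. *)
Lemma sum_cos_switch (R : realType) (T : finType) (I : eqType) (S : {set T})
    (tau : I -> T -> T) (h : T -> R) (delta : I -> T -> R) (s : seq I) :
  uniq s ->
  (forall i w, w \in S -> tau i w \in S) ->
  (forall i w, w \in S -> tau i (tau i w) = w) ->
  (forall i w, w \in S -> h (tau i w) = h w + delta i w) ->
  (forall i j w, i != j -> w \in S -> delta i (tau j w) = delta i w) ->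
  \sum_(w in S) cos (h w) =
  \sum_(w in S) (\prod_(i <- s) cos (delta i w / 2)) *
                cos (h w + \sum_(i <- s) delta i w / 2).
Proof.
move=> us tS tK th td; elim: s us => [_|i s IH /= /andP[si us]].
  by apply: eq_bigr => w _; rewrite !big_nil mul1r addr0.
rewrite IH //; set X := LHS.
have X2 : X = \sum_(w in S) (\prod_(j <- s) cos (delta j w / 2)) *
                cos (h w + delta i w + \sum_(j <- s) delta j w / 2).
  rewrite /X (reindex_onto (tau i) (tau i)) => [|w /tK //].
  apply: eq_big => [w|w /andP[tw /eqP ww]].
    apply/andP/idP => [[tw /eqP <-]|wS]; first exact: tS.
    by rewrite tS // tK.
  have wS : w \in S by rewrite -ww tS.
  rewrite th //; congr (_ * cos (_ + _)).
    by apply: eq_big_seq => j js; rewrite td //; apply: contraNneq si => <-.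
  by apply: eq_big_seq => j js; rewrite td //; apply: contraNneq si => <-.
apply: (@mulfI _ 2); first by rewrite pnatr_eq0.
have -> : 2 * X = X + X by ring.
rewrite {2}X2 -big_split /= mulr_sumr; apply: eq_bigr => w wS.
rewrite !big_cons -mulrDr.
set d := delta i w; set p := \prod_(_ <- _) _; set q := \sum_(_ <- _) _.
have -> : h w + q = (h w + q + d / 2) - d / 2 by ring.
have -> : h w + d + q = (h w + q + d / 2) + d / 2 by field.
have -> : h w + (d / 2 + q) = h w + q + d / 2 by ring.
by set al := h w + q + d / 2; rewrite (cosB al) (cosD al); ring.
Qed.

Lemma norm_sum_cos_switch_le (R : realType) (T : finType) (I : eqType) (S : {set T})
    (tau : I -> T -> T) (h : T -> R) (delta : I -> T -> R) (s : seq I) :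
  uniq s ->
  (forall i w, w \in S -> tau i w \in S) ->
  (forall i w, w \in S -> tau i (tau i w) = w) ->
  (forall i w, w \in S -> h (tau i w) = h w + delta i w) ->
  (forall i j w, i != j -> w \in S -> delta i (tau j w) = delta i w) ->
  `|\sum_(w in S) cos (h w)| <= \sum_(w in S) \prod_(i <- s) `|cos (delta i w / 2)|.
Proof.
move=> us tS tK th td; rewrite (sum_cos_switch us tS tK th td).
apply: (le_trans (ler_norm_sum _ _ _)); apply: ler_sum => w _.
rewrite normrM normr_prod ler_piMr ?cos_max //.
by apply: prodr_ge0.
Qed.

(** * Equidistribution of the number of parts *)

Definition nparts M b (w : conf M b) : nat := (\sum_(i < M) w i)%N.

(** * The involution attached to one relation *)

Section Switch.
Variables (M : nat) (U V : nat -> nat) (i0 : 'I_M).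
Hypotheses (U0 : (0 < U i0)%N) (V0 : V i0 = 0%N).
Implicit Type f : 'I_M -> nat.

Definition can_down f := odd (f i0 %/ U i0) && [forall i : 'I_M, U i <= f i]%N.
Definition can_up f := ~~ odd (f i0 %/ U i0) && [forall i : 'I_M, V i <= f i]%N.

(* Pairs the neighbours on the line [f + Z (U - V)] according to the parity of [f i0 %/ U i0],
   which changes by one along the line because [V i0 = 0]. *)
Definition swap f (i : 'I_M) : nat :=
  if can_down f then (f i - U i + V i)%N
  else if can_up f then (f i - V i + U i)%N else f i.

Lemma can_up_down f : can_up f -> can_down f = false.
Proof. by rewrite /can_up /can_down => /andP[/negPf->]. Qed.

Lemma can_down_swap f : can_down f -> can_up (swap f).
Proof.
move=> fd; case/andP: (fd) => fo /forallP fU; rewrite /can_up /swap fd V0 addn0.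
have -> : ((f i0 - U i0) %/ U i0 = (f i0 %/ U i0).-1)%N.
  by rewrite -{1}[U i0]mul1n divnBMl subn1.
have : (0 < f i0 %/ U i0)%N by case: (f i0 %/ U i0)%N fo.
case: (f i0 %/ U i0)%N fo => //= m -> _.
by apply/forallP => i; rewrite leq_addl.
Qed.

Lemma can_up_swap f : can_up f -> can_down (swap f).
Proof.
move=> fu; case/andP: (fu) => fo /forallP fV.
rewrite /can_down /swap (can_up_down fu) fu V0 subn0 divnDr // divnn U0 addn1 /= fo /=.
by apply/forallP => i; rewrite leq_addl.
Qed.

Lemma swapK f i : swap (swap f) i = f i.
Proof.
have [fd|fd] := boolP (can_down f).
  have fu := can_down_swap fd.
  rewrite {1}/swap fu (can_up_down fu) /swap fd.
  by case/andP: fd => _ /forallP/(_ i) ?; lia.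
have [fu|fu] := boolP (can_up f).
  rewrite {1}/swap (can_up_swap fu) /swap (negPf fd) fu.
  by case/andP: fu => _ /forallP/(_ i) ?; lia.
have e : swap f = f by apply/funext => j; rewrite /swap (negPf fd) (negPf fu).
by rewrite !e.
Qed.

Definition swap_sign f : int := if can_down f then -1 else if can_up f then 1 else 0.

(** Used for two linear forms: the mass, on which the relation takes the value 0, and the number of
    parts. *)
Lemma sum_swap f (c : nat -> nat) (g : int) :
  \sum_(i < M) (c i)%:Z * (U i)%:Z = g + \sum_(i < M) (c i)%:Z * (V i)%:Z ->
  \sum_(i < M) (c i)%:Z * (swap f i)%:Z = \sum_(i < M) (c i)%:Z * (f i)%:Z + swap_sign f * g.
Proof.
move=> UV; rewrite /swap /swap_sign; case: ifP => [/andP[_ /forallP fU]|_].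
  rewrite (eq_bigr (fun i : 'I_M => (c i)%:Z * (f i)%:Z - (c i)%:Z * (U i)%:Z
      + (c i)%:Z * (V i)%:Z)) => [|i _].
    by rewrite big_split sumrB /= UV; ring.
  by rewrite PoszD -subzn //; ring.
case: ifP => [/andP[_ /forallP fV]|_]; last by rewrite mul0r addr0.
rewrite (eq_bigr (fun i : 'I_M => (c i)%:Z * (f i)%:Z - (c i)%:Z * (V i)%:Z
    + (c i)%:Z * (U i)%:Z)) => [|i _].
  by rewrite big_split sumrB /= UV; ring.
by rewrite PoszD -subzn //; ring.
Qed.

Lemma swap_off f (i : 'I_M) : U i = 0%N -> V i = 0%N -> swap f i = f i.
Proof. by rewrite /swap => -> ->; rewrite subn0 addn0 !if_same. Qed.

(** Only coordinates in the support are tested. Hence a switch along a relation with disjoint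
    support preserves the sign, as [sum_cos_switch] requires. *)
Lemma swap_sign_local f f' : (forall i : 'I_M, U i != 0%N \/ V i != 0%N -> f i = f' i) ->
  swap_sign f = swap_sign f'.
Proof.
move=> ff; have e0 : f i0 = f' i0 by apply: ff; left; rewrite -lt0n.
have eU : [forall i : 'I_M, U i <= f i]%N = [forall i : 'I_M, U i <= f' i]%N.
  apply: eq_forallb => i; have [->//|Ui] := eqVneq (U i) 0%N.
  by rewrite ff //; left.
have eV : [forall i : 'I_M, V i <= f i]%N = [forall i : 'I_M, V i <= f' i]%N.
  apply: eq_forallb => i; have [->//|Vi] := eqVneq (V i) 0%N.
  by rewrite ff //; right.
by rewrite /swap_sign /can_down /can_up e0 eU eV.
Qed.

(** Both directions are open, so parity alone decides and the vector always moves. *)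
Lemma swap_sign_good f : (forall i : 'I_M, U i + V i <= f i)%N ->
  swap_sign f = 1 \/ swap_sign f = -1.
Proof.
move=> fUV; rewrite /swap_sign /can_down /can_up.
have -> : [forall i : 'I_M, U i <= f i]%N.
  by apply/forallP => i; apply: leq_trans (fUV i); rewrite leq_addr.
have -> : [forall i : 'I_M, V i <= f i]%N.
  by apply/forallP => i; apply: leq_trans (fUV i); rewrite leq_addl.
by rewrite !andbT; case: odd; [right|left].
Qed.
End Switch.

(** * Character sums over a family of disjoint relations *)

Section Equidistribution.
Variables (R : realType) (a : nat -> nat) (M b n T : nat) (g k c : nat).
Variables (U V : 'I_T -> nat -> nat) (i0 : 'I_T -> 'I_M).
Hypotheses (a_gt0 : forall i, (0 < a i)%N) (nb : (n <= b)%N).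
Hypotheses (U0 : forall t, (0 < U t (i0 t))%N) (V0 : forall t, V t (i0 t) = 0%N).
Hypothesis UVmass : forall t, (\sum_(i < M) a i * U t i = \sum_(i < M) a i * V t i)%N.
Hypothesis UVparts : forall t, (\sum_(i < M) U t i = g + \sum_(i < M) V t i)%N.
Hypothesis UVdisj : forall t t' (i : 'I_M), t != t' ->
  (U t i != 0 \/ V t i != 0)%N -> U t' i = 0%N /\ V t' i = 0%N.

Local Notation S := [set w : conf M b | mass a w == n]%SET.
Local Notation fn w := (fun i : 'I_M => nat_of_ord (w i)).

(** [inord] does no harm on [S]: the swapped vector still has mass [n], so its coordinates are at
    most [n <= b]. *)
Definition switch t (w : conf M b) : conf M b :=
  [ffun i => inord (swap (U t) (V t) (i0 t) (fn w) i)].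

Lemma mass_swap t (w : conf M b) :
  (\sum_(i < M) a i * swap (U t) (V t) (i0 t) (fn w) i = mass a w)%N.
Proof.
have h : \sum_(i < M) (a i)%:Z * (U t i)%:Z = 0 + \sum_(i < M) (a i)%:Z * (V t i)%:Z.
  rewrite add0r; have /(congr1 Posz) := UVmass t; rewrite !(big_morph Posz PoszD erefl).
  by under eq_bigr do rewrite PoszM; under [in RHS]eq_bigr do rewrite PoszM.
have := sum_swap (i0 t) (fn w) h; rewrite mulr0 addr0 => e.
apply/eqP; rewrite -eqz_nat /mass !(big_morph Posz PoszD erefl).
by under eq_bigr do rewrite PoszM; under [eqbRHS]eq_bigr do rewrite PoszM; rewrite e.
Qed.

Lemma switchE t (w : conf M b) : w \in S ->
  fn (switch t w) = swap (U t) (V t) (i0 t) (fn w).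
Proof.
rewrite inE => /eqP wn; apply/funext => i; rewrite ffunE inordK // ltnS.
apply: leq_trans nb; rewrite -wn -(mass_swap t) (bigD1 i) //=.
by rewrite (leq_trans _ (leq_addr _ _)) // leq_pmull.
Qed.

Lemma switch_in t w : w \in S -> switch t w \in S.
Proof.
move=> wS; move: (wS); rewrite !inE => /eqP <-; rewrite -(mass_swap t w).
by apply/eqP; apply: eq_bigr => i _; rewrite -(switchE t wS).
Qed.

Lemma switchK t w : w \in S -> switch t (switch t w) = w.
Proof.
move=> wS; apply/ffunP => i; apply: val_inj.
apply: (etrans (congr1 (@^~ i) (switchE t (switch_in t wS)))).
by rewrite (switchE t wS) swapK.
Qed.

Lemma nparts_switch t w : w \in S ->
  (nparts (switch t w))%:Z = (nparts w)%:Z + swap_sign (U t) (V t) (i0 t) (fn w) * g%:Z.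
Proof.
move=> wS.
have h : \sum_(i < M) 1%:Z * (U t i)%:Z = g%:Z + \sum_(i < M) 1%:Z * (V t i)%:Z.
  under eq_bigr do rewrite mul1r; under [in RHS]eq_bigr do rewrite mul1r.
  by rewrite -!(big_morph Posz PoszD erefl) UVparts.
have := sum_swap (c := fun=> 1%N) (i0 t) (fn w) h.
under eq_bigr do rewrite mul1r; under [X in _ = X + _]eq_bigr do rewrite mul1r.
rewrite -!(big_morph Posz PoszD erefl) => <-; congr Posz.
by apply: eq_bigr => i _; rewrite -(switchE t wS).
Qed.

Lemma swap_sign_switch t t' w : t != t' -> w \in S ->
  swap_sign (U t) (V t) (i0 t) (fn (switch t' w)) = swap_sign (U t) (V t) (i0 t) (fn w).
Proof.
move=> tt wS; apply: swap_sign_local => // i UVi.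
apply: (etrans (congr1 (@^~ i) (switchE t' wS))).
by case: (UVdisj tt UVi) => U' V'; rewrite swap_off.
Qed.

Definition good (w : conf M b) : {set 'I_T} :=
  [set t | [forall i : 'I_M, U t i + V t i <= w i]%N].

Hypotheses (k0 : (0 < k)%N) (kg : coprime k g).

Local Notation phase j w := (2 * (pi * (j * (nparts w + c))%:R / k%:R) : R).
Local Notation shift j t w :=
  (2 * (pi * (j%:R * (swap_sign (U t) (V t) (i0 t) (fn w) * g%:Z)%:~R) / k%:R) : R).

Lemma phase_switch (j : nat) t w : w \in S ->
  phase j (switch t w) = phase j w + shift j t w.
Proof.
move=> wS; have /(congr1 (fun z : int => z%:~R : R)) := nparts_switch t wS.
have kr : k%:R != 0 :> R by rewrite pnatr_eq0 -lt0n.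
by rewrite intrD -!pmulrn => e; rewrite !natrM !natrD e; field.
Qed.

(** A good relation shifts the phase by plus or minus [2 * pi * j * g / k], and [k] does not divide
    [j * g]. Vectors with at least [th] good relations get the decay; the others are bounded
    trivially. *)
Lemma norm_sum_phase_le th (j : nat) : ~~ (k %| j)%N ->
  `|\sum_(w in S) cos (phase j w)| <=
  #|S|%:R * expR (- (th%:R / (2 * k%:R ^+ 2))) + #|[set w in S | (#|good w| < th)%N]%SET|%:R.
Proof.
move=> kj; pose E : R := expR (- (2 * k%:R ^+ 2)^-1).
have kr : 0 < k%:R :> R by rewrite ltr0n.
have E0 : 0 <= E by apply: expR_ge0.
have E1 : E <= 1 by rewrite expR_le1 oppr_le0 invr_ge0 mulr_ge0 // exprn_ge0.
apply: (@le_trans _ _ (\sum_(w in S) \prod_(t <- index_enum 'I_T) `|cos (shift j t w / 2)|)).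
  apply: (norm_sum_cos_switch_le (tau := switch)); first exact: index_enum_uniq.
  - by move=> t w; apply: switch_in.
  - by move=> t w; apply: switchK.
  - by move=> t w; apply: phase_switch.
  - by move=> t t' w tt wS; rewrite (swap_sign_switch tt wS).
have -> : #|[set w in S | (#|good w| < th)%N]%SET|%:R =
    \sum_(w in S) (if (#|good w| < th)%N then 1 else 0) :> R.
  rewrite -big_mkcondr -sum1_card natr_sum; apply: eq_bigl => w.
  by rewrite !inE.
rewrite mulr_natl -sumr_const -big_split /=; apply: ler_sum => w wS.
have prodE : \prod_(t : 'I_T) `|cos (shift j t w / 2)| <= E ^+ #|good w|.
  rewrite -prodr_const [leRHS]big_mkcond; apply: ler_prod => t _.
  rewrite normr_ge0 /=; case: ifP => [|_]; last exact: cos_max.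
  rewrite inE => /forallP gw.
  have jg : ~~ (k %| j * g)%N by rewrite Gauss_dvdl.
  apply: le_trans (norm_cos_pi_frac_le R k0 jg).
  rewrite mulrAC divff ?pnatr_eq0 // mul1r natrM.
  by case: (swap_sign_good (i0 t) gw) => ->; rewrite ?mul1r ?mulN1r -?pmulrn // rmorphN /=
    -pmulrn mulrN mulrN mulNr cosN.
apply: (le_trans prodE); case: ltnP => gth.
  by rewrite ler_wpDl ?expR_ge0 // exprn_ile1.
rewrite addr0; have -> : expR (- (th%:R / (2 * k%:R ^+ 2))) = E ^+ th.
  by rewrite -expRM_natl mulrN.
exact: ler_wiXn2l.
Qed.

(** The [k] phases together detect divisibility by [k]; the phase [j = 0] is the main term. *)
Lemma equidistribution th :
  `|k%:R * #|[set w in S | (k %| nparts w + c)%N]%SET|%:R - #|S|%:R| <=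
  k%:R * (#|S|%:R * expR (- (th%:R / (2 * k%:R ^+ 2))) +
          #|[set w in S | (#|good w| < th)%N]%SET|%:R) :> R.
Proof.
have -> : k%:R * #|[set w in S | (k %| nparts w + c)%N]%SET|%:R =
    \sum_(j < k) \sum_(w in S) cos (phase j w).
  rewrite exchange_big /= -sum1_card natr_sum mulr_sumr.
  rewrite [in RHS](eq_bigr _ (fun w _ => sum_cos_orth R (nparts w + c) k0)).
  rewrite -big_mkcondr; apply: eq_big => [w|w _]; first by rewrite !inE.
  by rewrite mulr1.
set B := (X in _ <= _ * X); have B0 : 0 <= B by rewrite addr_ge0 ?mulr_ge0 ?expR_ge0.
have zero : \sum_(w in S) cos (phase 0 w) = #|S|%:R.
  rewrite -sum1_card natr_sum; apply: eq_bigr => w _.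
  by rewrite mul0n mulr0 mul0r mulr0 cos0.
rewrite (bigD1 (Ordinal k0)) //.
rewrite [X in `|X - _|](_ : _ = \sum_(w in S) cos (phase 0 w) +
   \sum_(j < k | j != Ordinal k0) \sum_(w in S) cos (phase j w)) // zero.
rewrite addrAC subrr add0r; apply: (le_trans (ler_norm_sum _ _ _)).
apply: (@le_trans _ _ (\sum_(j < k | j != Ordinal k0) B)).
  apply: ler_sum => j j0; apply: norm_sum_phase_le.
  apply: contra j0 => kj; apply/eqP/val_inj => /=; apply/eqP.
  by have := dvdn_leq _ kj; have := ltn_ord j; case: (nat_of_ord j) => //= m mk /(_ isT); lia.
rewrite big_mkcond /= mulr_natl -[X in _ *+ X]card_ord -sumr_const.
by apply: ler_sum => j _; case: ifP.
Qed.
End Equidistribution.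

(** * Disjoint relations between values of a polynomial *)

Section Blocks.
Variables (F : int -> int) (d : nat) (u : seq (int * int)) (N : nat).
Hypothesis F_diff : forall l h : int,
  \sum_(e < d.+2) (-1) ^+ e * 'C(d.+1, e)%:Z * F (l + e%:Z * h) = 0.
Hypothesis uN : forall x, x \in u -> `|x.2| <= N%:Z.

(* [F l] is the alternating binomial combination of the [F (l + (e + 1) h)], [e <= d], so the
   relation [u] is carried to arguments near the multiples of [h]. *)
Definition entries (h : nat) : seq (int * int) :=
  [seq (x.1 * ((-1) ^+ e * 'C(d.+1, e.+1)%:Z), x.2 + (e.+1 * h)%:Z)
    | x <- u, e <- iota 0 d.+1].

(** Applied to [F] to balance the masses, and to the constant 1 to count the parts. *)
Lemma sum_entries (G : int -> int) h :
  (forall l k : int, \sum_(e < d.+2) (-1) ^+ e * 'C(d.+1, e)%:Z * G (l + e%:Z * k) = 0) ->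
  \sum_(x <- entries h) x.1 * G x.2 = \sum_(x <- u) x.1 * G x.2.
Proof.
move=> Gd; rewrite /entries big_allpairs_dep; apply: eq_bigr => x _.
have e0 := Gd x.2 h%:Z; rewrite big_ord_recl /= expr0 bin0 !mul1r mul0r addr0 in e0.
move/eqP: e0; rewrite addr_eq0 => /eqP ->; rewrite mulrN mulr_sumr -sumrN.
rewrite -[iota 0 d.+1]/(index_iota 0 d.+1) big_mkord; apply: eq_bigr => e _ /=.
by rewrite /bump /= add1n exprS PoszM; ring.
Qed.

Definition weight (h i : nat) : int := \sum_(x <- entries h | x.2 == i.+1%:Z) x.1.

Lemma entriesP h x : x \in entries h ->
  exists2 e, (e < d.+1)%N & `|x.2 - (e.+1 * h)%:Z| <= N%:Z.
Proof.
case/allpairsPdep => y [e [yu]]; rewrite mem_iota add0n => ed ->.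
by exists e => //=; rewrite addrK uN.
Qed.

(** [N < h] makes all arguments positive, so that even nonpositive arguments of [u] are carried to
    indices of parts. *)
Lemma sum_weight_entries (G : int -> int) h M : (N < h)%N -> (d.+1 * h + N <= M)%N ->
  \sum_(i < M) weight h i * G i.+1%:Z = \sum_(x <- entries h) x.1 * G x.2.
Proof.
move=> Nh hM; rewrite /weight.
rewrite (eq_bigr (fun i : 'I_M => \sum_(x <- entries h) if x.2 == i.+1%:Z then x.1 * G x.2 else 0)).
  rewrite exchange_big /=; apply: eq_big_seq => x /entriesP[e ed].
  rewrite ler_norml => /andP[x1 x2].
  have xM : (`|x.2|.-1 < M)%N by nia.
  have x0 : x.2 = (`|x.2|.-1).+1%:Z by nia.
  rewrite (bigD1 (Ordinal xM)) //= -x0 eqxx big1 ?addr0 // => i.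
  rewrite -val_eqE /= => ix; case: eqP => // xi; move/eqP: ix; case; lia.
move=> i _; rewrite big_distrl /= big_mkcond; apply: eq_bigr => x _.
by case: eqP => // ->.
Qed.

(** The coefficients in [entries h] do not depend on [h], so dilation 0 bounds them all. *)
Definition weight_bound : nat := \sum_(x <- entries 0) `|x.1|%N.

Lemma weight_le h i : (`|weight h i| <= weight_bound)%N.
Proof.
have -> : weight_bound = (\sum_(x <- entries h) `|x.1|)%N.
  by rewrite /weight_bound /entries !big_allpairs_dep.
rewrite -lez_nat abszE /weight big_mkcond; apply: (le_trans (ler_norm_sum _ _ _)).
rewrite (big_morph Posz PoszD erefl); apply: ler_sum => x _.
by case: ifP; rewrite ?normr0.
Qed.

Lemma weight_support h i : weight h i != 0 ->
  exists2 e, (e < d.+1)%N & (i.+1 <= e.+1 * h + N)%N /\ (e.+1 * h <= i.+1 + N)%N.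
Proof.
move=> w0; have [x xh /eqP xi] : exists2 x, x \in entries h & x.2 == i.+1%:Z.
  apply/hasP; apply: contraNT w0 => /hasPn nh; rewrite /weight big_seq_cond.
  by rewrite big1 // => x /andP[/nh/negPf->].
case/entriesP: xh => e ed; rewrite xi ler_norml => /andP[h1 h2].
by exists e => //; split; lia.
Qed.

Lemma sum_alt_bin : \sum_(e < d.+2) (-1) ^+ e * 'C(d.+1, e)%:Z * (1 : int) = 0.
Proof.
have := exprBn (1 : int) 1 d.+1; rewrite subrr expr0n mulr0n => e0.
rewrite [RHS]e0; apply: eq_bigr => e _.
by rewrite !expr1n !mulr1 -[in RHS]mulr_natr natz ?mulr1.
Qed.

Variable T : nat.
Local Notation H := (2 * N + 1)%N.
(* Consecutive dilations differ by [2 N + 1] and the ranges of [(e + 1) h], [h < T * H * (d + 3)],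
   are disjoint for distinct [e <= d]; this separates the supports of the transported relations. *)
Definition dilation (t : nat) : nat := (d.+2 * H * T + H * t)%N.
Definition reach : nat := (d.+2 * (d.+3 * H) + N)%N.

Lemma dilation_ltn t t' : (t < t')%N -> (dilation t + H <= dilation t')%N.
Proof. by move=> tt; rewrite /dilation -addnA leq_add2l -mulnSr leq_mul2l tt orbT. Qed.

(** The offset [d.+2 * H * T] common to all dilations is at least [e.+1] times their spread [H * T],
    which keeps the different multiples apart. *)
Lemma dilation_lt_mul e e' t t' : (e < e')%N -> (e' < d.+1)%N -> (t < T)%N ->
  (e.+1 * dilation t + H <= e'.+1 * dilation t')%N.
Proof.
move=> ee ed tT; set D := (d.+2 * H * T)%N.
have stD : (dilation t + H <= D + H * T)%N.
  by rewrite /dilation -addnA leq_add2l -mulnSr leq_mul2l tT orbT.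
apply: (@leq_trans (e.+1 * (dilation t + H))); first by rewrite mulnDr leq_add2l leq_pmull.
apply: (@leq_trans (e.+1 * (D + H * T))); first by rewrite leq_mul2l stD orbT.
apply: (@leq_trans (e.+2 * D)).
  rewrite mulnDr [leqRHS]mulSn addnC leq_add2r /D -[leqRHS]mulnA leq_mul2r.
  by apply/orP; right; lia.
by apply: leq_mul; rewrite ?ltnS // /dilation leq_addr.
Qed.

Lemma weight_disjoint t t' i : (t < T)%N -> (t' < T)%N ->
  weight (dilation t) i != 0 -> weight (dilation t') i != 0 -> t = t'.
Proof.
move=> tT tT' /weight_support[e ed [h1 h2]] /weight_support[e' ed' [h1' h2']].
have [ee|ee|ee] := ltngtP e e'.
- by have := @dilation_lt_mul e e' t t' ee ed' tT; lia.
- by have := @dilation_lt_mul e' e t' t ee ed tT'; lia.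
subst e'; have [tt|tt|//] := ltngtP t t'.
- have : (e.+1 * (dilation t + H) <= e.+1 * dilation t')%N by rewrite leq_mul2l dilation_ltn ?orbT.
  rewrite mulnDr => h; have : (H <= e.+1 * H)%N by rewrite leq_pmull.
  lia.
- have : (e.+1 * (dilation t' + H) <= e.+1 * dilation t)%N by rewrite leq_mul2l dilation_ltn ?orbT.
  rewrite mulnDr => h; have : (H <= e.+1 * H)%N by rewrite leq_pmull.
  lia.
Qed.

Definition weight_pos (t i : nat) : nat := `|Num.max (weight (dilation t) i) 0|%N.
Definition weight_neg (t i : nat) : nat := `|Num.max (- weight (dilation t) i) 0|%N.

Lemma weight_posB t i : (weight_pos t i)%:Z = weight (dilation t) i + (weight_neg t i)%:Z.
Proof. rewrite /weight_pos /weight_neg; lia. Qed.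

Lemma weight_pos_neg_le t i : (weight_pos t i + weight_neg t i <= weight_bound)%N.
Proof. by apply: leq_trans (weight_le (dilation t) i); rewrite /weight_pos /weight_neg; lia. Qed.

Lemma weight_pos_neg_neq0 t i : weight_pos t i != 0%N \/ weight_neg t i != 0%N ->
  weight (dilation t) i != 0.
Proof. by rewrite /weight_pos /weight_neg; case; apply: contraNneq => ->. Qed.

Lemma weight_pos_neg_disjoint t t' i : (t < T)%N -> (t' < T)%N -> t != t' ->
  weight_pos t i != 0%N \/ weight_neg t i != 0%N -> weight_pos t' i = 0%N /\ weight_neg t' i = 0%N.
Proof.
move=> tT tT' tt /weight_pos_neg_neq0 w0.
have w0' : weight (dilation t') i = 0.
  by apply/eqP; apply: contraNT tt => w0'; apply/eqP; apply: (weight_disjoint (i := i)).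
by rewrite /weight_pos /weight_neg w0'.
Qed.

Lemma dilation_reach t : (t < T)%N -> (d.+1 * dilation t + N <= reach * T)%N.
Proof.
move=> tT; have T0 : (0 < T)%N by apply: leq_ltn_trans tT.
have st : (dilation t <= d.+3 * H * T)%N.
  have -> : (d.+3 * H * T = d.+2 * H * T + H * T)%N by rewrite (mulSn d.+2) mulnDl addnC.
  by rewrite /dilation leq_add2l leq_mul2l (ltnW tT) orbT.
rewrite /reach mulnDl -!mulnA; apply: leq_add; last by rewrite leq_pmulr.
by apply: leq_mul => //; rewrite mulnA.
Qed.

Lemma N_lt_dilation t : (0 < T)%N -> (N < dilation t)%N.
Proof.
move=> T0; apply: leq_trans (leq_addr _ _); rewrite -mulnA.
apply: (@leq_trans (1 * (H * T))); last by rewrite leq_mul2r orbC.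
by rewrite mul1n; apply: leq_trans (leq_pmulr _ T0); lia.
Qed.

Lemma weight_pos_support t i : (t < T)%N -> weight_pos t i != 0%N \/ weight_neg t i != 0%N ->
  (i < reach * T)%N.
Proof.
move=> tT /weight_pos_neg_neq0/weight_support[e ed [ie _]].
apply: leq_trans (dilation_reach tT); apply: (leq_trans ie).
by rewrite leq_add2r leq_mul2r ed orbT.
Qed.

(** A relation that is not good has a low multiplicity somewhere in its support; disjoint supports
    make the choice of that index injective. *)
Lemma card_good_ge M b (w : conf M b) :
  (T <= #|good (fun t : 'I_T => weight_pos t) (fun t : 'I_T => weight_neg t) w|
        + low (reach * T) weight_bound w)%N.
Proof.
set G := good _ _ _; rewrite -{1}[T]card_ord -(cardsC G) leq_add2l.
have [/eqP c0|] := eqVneq #|~: G| 0%N; first by rewrite (eqP c0).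
rewrite -lt0n => /card_gt0P[t0]; rewrite !inE negb_forall => /existsP[j0 _].
pose f (t : 'I_T) := odflt j0 [pick i : 'I_M | (w i < weight_pos t i + weight_neg t i)%N].
have fP t : t \in ~: G -> (w (f t) < weight_pos t (f t) + weight_neg t (f t))%N.
  rewrite !inE negb_forall /f => /existsP[i]; rewrite -ltnNge => wi.
  by case: pickP => [//|/(_ i)]; rewrite wi.
have nz t i : (w i < weight_pos t i + weight_neg t i)%N ->
    weight_pos t i != 0%N \/ weight_neg t i != 0%N.
  by move=> h; case: (eqVneq (weight_pos t i) 0%N) => p0; [right|left]; lia.
have finj : {in ~: G &, injective f}.
  move=> t t' tG tG' ff; apply/val_inj/eqP => /=; apply/negPn/negP => tt.
  have [p0 n0] := weight_pos_neg_disjoint (ltn_ord t) (ltn_ord t') tt (nz _ _ (fP _ tG)).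
  by have := fP _ tG'; rewrite -ff p0 n0.
rewrite -(card_in_imset finj); apply: subset_leq_card; apply/fintype.subsetP => i.
case/imsetP => t tG ->; have h := fP _ tG.
rewrite inE (weight_pos_support (ltn_ord t) (nz _ _ h)) /=.
exact: leq_trans h (weight_pos_neg_le _ _).
Qed.
Variables (a : nat -> nat) (g M : nat).
Hypotheses (Fa : forall i : nat, F i.+1%:Z = (a i)%:Z) (g_gt0 : (0 < g)%N).
Hypothesis uF : \sum_(x <- u) x.1 * F x.2 = 0.
Hypothesis ug : \sum_(x <- u) x.1 = g%:Z.
Hypothesis MT : (reach * T <= M)%N.

Lemma weight_pos_mass t : (t < T)%N ->
  (\sum_(i < M) a i * weight_pos t i = \sum_(i < M) a i * weight_neg t i)%N.
Proof.
move=> tT; have T0 : (0 < T)%N by apply: leq_ltn_trans tT.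
have hM := leq_trans (dilation_reach tT) MT.
have e : \sum_(i < M) weight (dilation t) i * F i.+1%:Z = 0.
  by rewrite (sum_weight_entries _ (N_lt_dilation t T0) hM) sum_entries.
apply/eqP; rewrite -eqz_nat !(big_morph Posz PoszD erefl) -subr_eq0 -sumrB; apply/eqP.
rewrite -[RHS]e; apply: eq_bigr => i _.
by rewrite !PoszM weight_posB Fa; ring.
Qed.

Lemma weight_pos_parts t : (t < T)%N ->
  (\sum_(i < M) weight_pos t i = g + \sum_(i < M) weight_neg t i)%N.
Proof.
move=> tT; have T0 : (0 < T)%N by apply: leq_ltn_trans tT.
have hM := leq_trans (dilation_reach tT) MT.
have e : \sum_(i < M) weight (dilation t) i * (1 : int) = g%:Z.
  apply: (etrans (sum_weight_entries (fun=> 1) (N_lt_dilation t T0) hM)).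
  apply: (etrans (sum_entries (G := fun=> 1) _ _)) => [_ _|]; first exact: sum_alt_bin.
  by under eq_bigr do rewrite mulr1.
apply/eqP; rewrite -eqz_nat PoszD !(big_morph Posz PoszD erefl) -subr_eq -sumrB; apply/eqP.
rewrite -[RHS]e; apply: eq_bigr => i _.
by rewrite weight_posB; ring.
Qed.

Lemma weight_pos_pick t : (t < T)%N ->
  exists i0 : 'I_M, (0 < weight_pos t i0)%N /\ weight_neg t i0 = 0%N.
Proof.
clear uF => tT; have := weight_pos_parts tT.
have [/existsP[i pi] _|/existsPn np] := boolP [exists i : 'I_M, (0 < weight_pos t i)%N].
  by exists i; split => //; move: pi; rewrite /weight_pos /weight_neg; lia.
rewrite big1 => [/esym/eqP|i _]; last by apply/eqP; rewrite -leqn0 leqNgt.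
by rewrite addn_eq0 -leqn0 leqNgt g_gt0.
Qed.

End Blocks.

(** * Values of an admissible polynomial *)

Lemma sum_alt_binS (R : comNzRingType) (g : nat -> R) m :
  \sum_(e < m.+2) (-1) ^+ e * 'C(m.+1, e)%:R * g e =
  \sum_(e < m.+1) (-1) ^+ e * 'C(m, e)%:R * (g e - g e.+1).
Proof.
rewrite big_ord_recl /= expr0 bin0 !mul1r.
under [RHS]eq_bigr do rewrite mulrBr.
rewrite sumrB.
rewrite [in RHS]big_ord_recl /= expr0 bin0 !mul1r -addrA; congr (_ + _).
have -> : \sum_(i < m) (-1) ^+ bump 0 i * 'C(m, bump 0 i)%:R * g (bump 0 i) =
   \sum_(i < m.+1) (-1) ^+ i.+1 * 'C(m, i.+1)%:R * g i.+1.
  by rewrite big_ord_recr /= bin_small // mulr0 mul0r addr0.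
rewrite -sumrB; apply: eq_bigr => e _.
by rewrite /bump /= add1n binS natrD exprS; ring.
Qed.

Lemma size_poly_diff (R : idomainType) (p : {poly R}) (h : R) m :
  (size p <= m.+1)%N -> (size (p - (p \Po ('X + h%:P)))%R <= m)%N.
Proof.
move=> pm; have s2 : size ('X + h%:P) = 2%N by rewrite size_XaddC.
have sc : size (p \Po ('X + h%:P)) = size p by rewrite size_comp_poly2.
apply/leq_sizeP => j mj; rewrite coefB; have [pj|pj] := leqP (size p) j.
  by rewrite !nth_default ?subrr // sc.
have ej : j = (size p).-1 by lia.
have lc : lead_coef (p \Po ('X + h%:P)) = lead_coef p.
  by rewrite lead_coef_comp ?s2 // lead_coefXaddC expr1n mulr1.
by rewrite ej -{2}sc -!lead_coefE lc subrr.
Qed.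

(** Pascal's rule peels off one difference, which lowers the size of the polynomial. *)
Lemma horner_diff (R : idomainType) (p : {poly R}) m (x h : R) : (size p <= m)%N ->
  \sum_(e < m.+1) (-1) ^+ e * 'C(m, e)%:R * p.[x + e%:R * h] = 0.
Proof.
elim: m p => [|m IH] p pm.
  move: pm; rewrite leqn0 size_poly_eq0 => /eqP ->.
  by rewrite big1 // => e _; rewrite horner0 mulr0.
rewrite (sum_alt_binS (fun e => p.[x + e%:R * h])).
rewrite -[RHS](IH _ (size_poly_diff h pm)); apply: eq_bigr => e _.
rewrite hornerD hornerN horner_comp hornerD hornerX hornerC -natr1 mulrDl mul1r.
by rewrite addrA.
Qed.

Section Arithmetic.
Variable f : {poly rat}.
Hypothesis f_adm : admissible f.

Local Notation F := (int_value f).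
Local Notation d := (poly_deg f).

Lemma int_valueE l : (F l)%:~R = f.[l%:~R].
Proof. by case: f_adm => _ fint _ _; rewrite /int_value; apply: floorK. Qed.

Lemma deg_gt0 : (0 < d)%N. Proof. by case: f_adm. Qed.

Lemma int_value_diff (l h : int) :
  \sum_(e < d.+2) (-1) ^+ e * 'C(d.+1, e)%:Z * F (l + e%:Z * h) = 0.
Proof.
apply: (@intr_inj rat); rewrite rmorph_sum /=.
have sz : (size f <= d.+1)%N by rewrite /poly_deg; case: (size f).
rewrite -[RHS](horner_diff l%:~R h%:~R sz); apply: eq_bigr => e _.
by rewrite !rmorphM /= rmorphXn /= rmorphN1 int_valueE rmorphD rmorphM /= -!pmulrn.
Qed.

Definition val_at (i : nat) : nat := `|F i.+1%:Z|%N.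

Lemma int_value_gt0 (i : nat) : 0 < F i.+1%:Z.
Proof.
rewrite -(ltr0z rat) int_valueE; case: f_adm => _ _ f0 _; exact: f0.
Qed.

Lemma val_atE (i : nat) : F i.+1%:Z = (val_at i)%:Z.
Proof. by rewrite /val_at gez0_abs // ltW // int_value_gt0. Qed.

Lemma val_at_gt0 i : (0 < val_at i)%N.
Proof. by rewrite -ltz_nat -val_atE int_value_gt0. Qed.

Lemma horner_val_at i : f.[i.+1%:R] = (val_at i)%:R.
Proof. by have := int_valueE i.+1%:Z; rewrite val_atE -!pmulrn. Qed.

Let A : rat := \sum_(i < size f) `|f`_i|.

Lemma val_at_hi : exists C, forall i, (val_at i <= C * i.+1 ^ d)%N.
Proof.
exists (Num.truncn A).+1 => i; rewrite -(ler_nat rat) natrM natrX -horner_val_at.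
apply: (@le_trans _ _ (A * i.+1%:R ^+ d)); last first.
  by rewrite ler_wpM2r ?exprn_ge0 ?ler0n // ltW // truncnS_gt.
rewrite horner_coef /A mulr_suml; apply: ler_sum => j _.
apply: (le_trans (ler_norm _)); rewrite normrM ler_wpM2l //.
rewrite ger0_norm ?exprn_ge0 ?ler0n // ler_weXn2l ?ler1n //.
by rewrite -ltnS (leq_trans (ltn_ord j)) // /poly_deg leqSpred.
Qed.

(** Beyond [L] the lower order terms are at most half of the leading one; up to [L] the bound
    [1 <= val_at i] suffices. *)
Lemma val_at_lo : exists C, forall i, (i.+1 ^ d <= C * val_at i)%N.
Proof.
have d0 := deg_gt0; have sz : size f = d.+1 by move: d0; rewrite /poly_deg; case: (size f).
have A0 : 0 <= A by apply: sumr_ge0.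
set c := `|lead_coef f|; have c0 : 0 < c.
  by rewrite normr_gt0 lead_coef_eq0 -size_poly_eq0 sz.
have main i : c * i.+1%:R ^+ d <= (val_at i)%:R + A * i.+1%:R ^+ d.-1.
  have i1 : 1 <= i.+1%:R :> rat by rewrite ler1n.
  rewrite -horner_val_at.
  have -> : c * i.+1%:R ^+ d = `|lead_coef f * i.+1%:R ^+ d|.
    by rewrite normrM [X in _ = _ * X]ger0_norm // exprn_ge0 ?ler0n.
  have e : lead_coef f * i.+1%:R ^+ d =
     f.[i.+1%:R] - \sum_(j < d) f`_j * i.+1%:R ^+ j.
    by rewrite horner_coef sz big_ord_recr /= lead_coefE sz addrAC subrr add0r.
  rewrite e; apply: (le_trans (ler_normB _ _)).
  rewrite ger0_norm ?lerD2l; last by rewrite horner_val_at ler0n.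
  apply: (le_trans (ler_norm_sum _ _ _)).
  rewrite /A sz big_ord_recr /= mulrDl -[leLHS]addr0; apply: lerD; last first.
    by rewrite mulr_ge0 // exprn_ge0 ?ler0n.
  rewrite mulr_suml; apply: ler_sum => j _; rewrite normrM ler_wpM2l //.
  rewrite ger0_norm ?exprn_ge0 ?ler0n // ler_weXn2l //.
  by have := ltn_ord j; lia.
pose L := (Num.truncn (2 * A / c)).+1; pose C1 := (Num.truncn (2 / c)).+1.
exists (L ^ d + C1)%N => i; have vi := val_at_gt0 i.
have [iL|Li] := leqP i.+1 L.
  apply: (@leq_trans (L ^ d)); first by rewrite leq_exp2r.
  by rewrite mulnDl; apply: leq_trans (leq_addr _ _); rewrite leq_pmulr.
rewrite mulnDl; apply: leq_trans (leq_addl _ _).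
rewrite -(ler_nat rat) natrM natrX.
have hL : 2 * A <= c * i.+1%:R.
  rewrite -ler_pdivrMl // mulrC; apply: ltW; apply: (lt_le_trans (truncnS_gt _)).
  by rewrite ler_nat ltnW.
have hd : i.+1%:R ^+ d = i.+1%:R * i.+1%:R ^+ d.-1 :> rat by rewrite -exprS prednK.
have m0 := main i; set P : rat := i.+1%:R ^+ d.-1 in hd m0.
have P0 : 0 <= P by rewrite exprn_ge0 ?ler0n.
have h1 : c * i.+1%:R ^+ d <= 2 * (val_at i)%:R by move: m0; rewrite hd; nra.
apply: (@le_trans _ _ (2 / c * (val_at i)%:R)).
  by rewrite mulrAC ler_pdivlMr // mulrC.
by rewrite ler_wpM2r ?ler0n // ltW // truncnS_gt.
Qed.

Lemma val_at_growth : exists C, (forall i, (i.+1 ^ d <= C * val_at i)%N) /\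
  (forall i, (val_at i <= C * i.+1 ^ d)%N).
Proof.
have [C1 h1] := val_at_lo; have [C2 h2] := val_at_hi; exists (C1 + C2)%N; split => i.
  by apply: (leq_trans (h1 i)); rewrite leq_mul2r leq_addr orbT.
by apply: (leq_trans (h2 i)); rewrite leq_mul2r leq_addl orbT.
Qed.
End Arithmetic.

(** * Integer relations between the values *)

(** Bezout for a possibly infinite family: [g] is the least positive integral combination, or 0 if
    all values vanish. *)
Lemma int_gcd_comb (I : Type) (G : I -> int) : exists (g : nat) (s : seq (int * I)),
  g%:Z = \sum_(x <- s) x.1 * G x.2 /\ forall i, (g%:Z %| G i)%Z.
Proof.
pose C (m : nat) := exists s : seq (int * I), m%:Z = \sum_(x <- s) x.1 * G x.2.
have comb_abs (z : int) s : z = \sum_(x <- s) x.1 * G x.2 -> C `|z|%N.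
  move=> zs; case: (lerP 0 z) => z0.
    by exists s; rewrite gez0_abs.
  exists [seq (- x.1, x.2) | x <- s]; rewrite big_map /= ltz0_abs // zs -sumrN.
  by apply: eq_bigr => x _; rewrite mulNr.
have [[i0 Gi0]|allz] := pselect (exists i, G i != 0); last first.
  exists 0%N, [::]; rewrite big_nil; split => // i; apply: contrapT => ni.
  by apply: allz; exists i; apply: contra_notN ni => /eqP->; rewrite dvdz0.
pose P (m : nat) := (0 < m)%N && `[< C m >].
have exP : exists m, P m.
  exists `|G i0|%N; rewrite /P absz_gt0 Gi0; apply/asboolP.
  by apply: (comb_abs _ [:: (1, i0)]); rewrite big_seq1 mul1r.
case: (ex_minnP exP) => g /andP[g0 /asboolP [s gs]] gmin.
exists g, s; split => // i.
apply/negPn/negP => ng.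
have r0 : (G i %% g%:Z)%Z != 0 by apply: contra ng => /eqP h; apply/dvdz_mod0P.
have rlt : (G i %% g%:Z)%Z < g%:Z by rewrite ltz_pmod.
have rge : 0 <= (G i %% g%:Z)%Z by rewrite modz_ge0 //; lia.
have : P `|(G i %% g%:Z)%Z|%N.
  rewrite /P absz_gt0 r0; apply/asboolP.
  apply: (comb_abs _ ((1, i) :: [seq (- (G i %/ g%:Z)%Z * x.1, x.2) | x <- s])).
  rewrite big_cons big_map /= mul1r.
  rewrite (eq_bigr (fun x => - (G i %/ g%:Z)%Z * (x.1 * G x.2))) => [|x _]; last by rewrite mulrA.
  rewrite -mulr_sumr -gs mulNr; apply/eqP; rewrite eq_sym subr_eq addrC; apply/eqP.
  exact: divz_eq.
by move/gmin; lia.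
Qed.

Section Relations.
Variable f : {poly rat}.
Hypothesis f_adm : admissible f.

Local Notation F := (int_value f).
Local Notation d := (poly_deg f).
Local Notation a := (val_at f).

Lemma val_at_unbounded m : exists i, (m < a i)%N.
Proof.
have [C [Clo _]] := val_at_growth f_adm.
exists (C * m)%N; have := Clo (C * m)%N; have d0 := deg_gt0 f_adm.
have : ((C * m).+1 <= (C * m).+1 ^ d)%N by rewrite -[leqLHS]expn1 leq_pexp2l.
move=> h1 h2; have := leq_trans h1 h2; rewrite ltn_mul2l => /andP[].
by [].
Qed.

Lemma exists_diff_neq0 : exists l, F l - F 0 != 0.
Proof.
have [i hi] := val_at_unbounded `|F 0|%N; exists i.+1%:Z.
by rewrite val_atE //; lia.
Qed.

Lemma dvd_diffs_bound p s l : prime p -> F l - F 0 != 0 -> pow_dvd_diffs f p s ->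
  (p ^ s <= `|(F l - F 0)%R|)%N.
Proof.
by move=> pp l0 /(_ l); rewrite dvdzE /= => /dvdn_leq; apply; rewrite absz_gt0.
Qed.

(** A nonzero difference bounds the exponents, so the maximum exists and the default of [xget] is
    not taken. *)
Lemma max_powP p : prime p ->
  pow_dvd_diffs f p (max_pow f p) /\
  forall t, pow_dvd_diffs f p t -> (t <= max_pow f p)%N.
Proof.
move=> pp; have [l l0] := exists_diff_neq0; rewrite /max_pow.
apply: (xgetPex 0%N (P := [set s | pow_dvd_diffs f p s /\
                    forall t, pow_dvd_diffs f p t -> (t <= s)%N])).
have ex0 : exists s, `[< pow_dvd_diffs f p s >].
  by exists 0%N; apply/asboolP => k; rewrite expn0 dvd1z.
have bnd s : `[< pow_dvd_diffs f p s >] -> (s <= `|(F l - F 0)%R|)%N.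
  move/asboolP/(dvd_diffs_bound pp l0); apply: leq_trans; apply: ltnW.
  exact: ltn_expl (prime_gt1 pp).
case: (ex_maxnP ex0 bnd) => s /asboolP ps smax; exists s; split => // t pt.
by apply: smax; apply/asboolP.
Qed.

Lemma prime_dvd_Pi p : prime p -> (forall l, (p%:Z %| F l - F 0)%Z) -> (p %| Pi_ f)%N.
Proof.
move=> pp pd; have [l l0] := exists_diff_neq0.
have m1 q : prime q -> (q <= `|(F l - F 0)%R|)%N \/ max_pow f q = 0%N.
  move=> qq; have [-> |m0] := eqVneq (max_pow f q) 0%N; [by right|left].
  apply: leq_trans (dvd_diffs_bound qq l0 (max_powP qq).1).
  by rewrite -[leqLHS]expn1; apply: leq_pexp2l; [exact: prime_gt0|rewrite lt0n].
set r := [seq q <- iota 0 `|(F l - F 0)%R|.+1 | prime q].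
have ur : uniq r by rewrite filter_uniq // iota_uniq.
have rA : [set` r] `<=` [set q | prime q].
  by move=> q /=; rewrite mem_filter => /andP[].
rewrite /Pi_ (fsbigE r _ ur rA); last first.
  move=> q /= qq; rewrite mem_filter qq mem_iota add0n /= ltnS => nq.
  by case: (m1 q qq) => [h|->//]; move: nq; rewrite h.
have m1p : (1 <= max_pow f p)%N.
  by apply: (max_powP pp).2 => k; rewrite expn1.
have pr : p \in r.
  rewrite mem_filter pp mem_iota add0n ltnS /=.
  by case: (m1 p pp) => // h; rewrite h in m1p.
rewrite big_mkcond (bigD1_seq p) //= mem_set //.
by rewrite dvdn_mulr // dvdn_exp.
Qed.

Lemma unit_relation : exists (g : nat) (u : seq (int * int)),
  [/\ (0 < g)%N, \sum_(x <- u) x.1 * F x.2 = 0, \sum_(x <- u) x.1 = g%:Z &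
   forall k, coprime k (Pi_ f) -> coprime k g].
Proof.
have [g [s [gs gd]]] := int_gcd_comb (fun l => F l - F 0).
have [l l0] := exists_diff_neq0.
(* Multiplying [g = \sum c_i * (F l_i - F 0)] by [F 0] gives a relation among values: [g] copies of
   [F 0] against the right-hand side. The coefficients coming from the latter cancel, so the total
   is [g]. *)
exists g, ((g%:Z, 0) :: [seq (- F 0 * x.1, x.2) | x <- s] ++ [seq (F 0 * x.1, 0) | x <- s]).
have g0 : (0 < g)%N.
  by rewrite lt0n; apply: contraNneq l0 => g0; have := gd l; rewrite g0 dvd0z.
split => //.
- rewrite big_cons big_cat !big_map /= [X in X * _]gs mulr_suml -!big_split /=.
  by apply: big1 => x _; ring.
- rewrite big_cons big_cat !big_map /= -big_split /= big1 ?addr0 // => x _.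
  by rewrite mulNr addNr.
move=> k kPi; rewrite /coprime; apply: contraT => gk1.
have [p pp pkg] : {p | prime p & (p %| gcdn k g)%N}.
  by apply: pdivP; rewrite ltn_neqAle eq_sym gk1 gcdn_gt0 g0 orbT.
move: pkg; rewrite dvdn_gcd => /andP[pk pg].
have pPi : (p %| Pi_ f)%N.
  by apply: prime_dvd_Pi => // i; apply: dvdz_trans (gd i); rewrite dvdzE.
have : (p %| gcdn k (Pi_ f))%N by rewrite dvdn_gcd pk.
by rewrite (eqP kPi) dvdn1 => /eqP p1; rewrite p1 in pp.
Qed.

(** Differences of step [|l| + 1] lead to positive arguments. Thus a common divisor of the parts
    divides all values, and admissibility forces it to be 1. *)
Lemma int_value_combination l : exists s : seq (int * nat), F l = \sum_(x <- s) x.1 * (a x.2)%:Z.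
Proof.
pose h : int := `|l| + 1.
exists [seq (- ((-1) ^+ e.+1 * 'C(d.+1, e.+1)%:Z), `|(l + e.+1%:Z * h)%R|%N.-1) | e <- iota 0 d.+1].
have := int_value_diff f_adm l h; rewrite big_ord_recl expr0 bin0 !mul1r mul0r addr0.
move/eqP; rewrite addr_eq0 => /eqP ->.
rewrite big_map -[iota 0 d.+1]/(index_iota 0 d.+1) big_mkord -sumrN.
apply: eq_bigr => e _ /=; rewrite -val_atE // /bump add1n mulNr; congr (- (_ * F _)).
rewrite /h; nia.
Qed.

Lemma val_at_combination : exists s : seq (int * nat), \sum_(x <- s) x.1 * (a x.2)%:Z = 1.
Proof.
have [g [s [gs gd]]] := int_gcd_comb (fun i => (a i)%:Z).
have gF l : (g%:Z %| F l)%Z.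
  have [t ->] := int_value_combination l; apply: rpred_sum => x _.
  by apply: dvdz_mull; exact: gd.
exists s; rewrite -gs; congr Posz; apply/eqP; apply: contraT => g1.
have g0 : (0 < g)%N.
  rewrite lt0n; apply: contraTneq (gd 0%N) => ->.
  by rewrite dvd0z eqz_nat -lt0n val_at_gt0.
have [p pp pg] : {p | prime p & (p %| g)%N}.
  by apply: pdivP; rewrite ltn_neqAle eq_sym g1.
case: f_adm => _ _ _ /(_ p pp)[l /negP]; case.
by apply: dvdz_trans (gF l); rewrite dvdzE.
Qed.

Lemma val_at_semigroup : exists N0 Q : nat, forall h, (N0 <= h)%N -> exists m : nat -> nat,
  (forall i, m i != 0%N -> (i < Q)%N) /\ (\sum_(i < Q) a i * m i = h)%N.
Proof.
have [s s1] := val_at_combination.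
pose pos (x : int * nat) := `|Num.max x.1 0|%N; pose neg (x : int * nat) := `|Num.max (- x.1) 0|%N.
pose P := (\sum_(x <- s) a x.2 * neg x)%N.
have Pp : (\sum_(x <- s) a x.2 * pos x = P.+1)%N.
  apply/eqP; rewrite -eqz_nat -addn1 PoszD /P !(big_morph Posz PoszD erefl).
  rewrite addrC -subr_eq -sumrB -[eqbRHS]/(1 : int) -s1; apply/eqP/eq_bigr => x _.
  have : (pos x)%:Z - (neg x)%:Z = x.1 by rewrite /pos /neg; lia.
  by move=> <-; rewrite !PoszM; ring.
pose Q := (\sum_(x <- s) x.2).+1.
have xQ x : x \in s -> (x.2 < Q)%N.
  by move=> xs; rewrite /Q ltnS (big_rem x) //= leq_addr.
(* [P] and [P + 1] are both sums of parts, and [h = q * P + r = (q - r) * P + r * (P + 1)], where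
   [r < P <= q] for positive [P]. *)
exists (P ^ 2)%N, Q => h hP; pose q := (h %/ P)%N; pose r := (h %% P)%N.
have hqr : ((q - r) * P + r * P.+1 = h)%N.
  (* For [P = 0] the conventions [q = 0] and [r = h] leave [h] copies of 1. *)
  have [P0|P0] := posnP P; first by rewrite /q /r P0 divn0 modn0 muln0 muln1.
  have rq : (r <= q)%N.
    apply: ltnW; apply: leq_trans (ltn_pmod h P0) _.
    by rewrite leq_divRL // -expnSr.
  by rewrite mulnS mulnBl [RHS](divn_eq h P) -/q -/r; have := leq_mul rq (leqnn P); lia.
exists (fun i => \sum_(x <- s | x.2 == i) ((q - r) * neg x + r * pos x))%N; split.
  move=> i; apply: contraNltn => Qi; rewrite big_seq_cond big1 // => x /andP[/xQ xs /eqP xi].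
  by move: Qi; rewrite -xi leqNgt xs.
rewrite -[RHS]hqr -Pp /P !big_distrr -big_split /=.
rewrite (eq_bigr (fun i : 'I_Q => \sum_(x <- s) if x.2 == i then
   a x.2 * ((q - r) * neg x + r * pos x) else 0)%N); last first.
  move=> i _; rewrite big_distrr /= big_mkcond; apply: eq_bigr => x _.
  by case: eqP => // ->.
rewrite exchange_big /=; apply: eq_big_seq => x /xQ xs.
rewrite (bigD1 (Ordinal xs)) //= eqxx big1 ?addn0; first by rewrite mulnDr; nia.
by move=> i; rewrite -val_eqE /= eq_sym => /negPf->.
Qed.
End Relations.

(** * Partitions as multiplicity vectors *)

Section Configurations.
Variable f : {poly rat}.
Hypothesis f_adm : admissible f.
Variables (M b n : nat).
Hypotheses (nb : (n <= b)%N) (aM : forall i, (M <= i)%N -> (n < val_at f i)%N).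

Local Notation a := (val_at f).

Definition parts_seq (w : conf M b) : seq nat :=
  flatten [seq nseq (w i) i.+1 | i <- enum 'I_M].

Definition mset_of (w : conf M b) : {mset nat}%mset := seq_mset (parts_seq w).

Lemma big_mset_of (R : nmodType) (w : conf M b) (G : nat -> R) :
  \sum_(l <- mset_of w) G l = \sum_(i < M) G i.+1 *+ w i.
Proof.
rewrite (perm_big _ (perm_eq_seq_mset _)) big_flatten /= big_map big_enum /=.
apply: eq_bigr => i _; elim: (nat_of_ord (w i)) => [|m IH]; first by rewrite big_nil mulr0n.
by rewrite big_cons IH mulrS.
Qed.

Lemma size_mset_of w : size (mset_of w) = nparts w.
Proof.
rewrite -sum1_size (big_mset_of w (fun=> 1%N)) /nparts; apply: eq_bigr => i _.
by rewrite -mulr_natl natn mulr1.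
Qed.

Lemma mset_ofE w (i : 'I_M) : mset_of w i.+1 = w i.
Proof.
rewrite -count_mem_mset -sum1_count big_mkcond.
rewrite (big_mset_of w (fun l => if pred1 i.+1 l then 1%N else 0%N)).
rewrite (bigD1 i) //= eqxx big1 ?addr0; first by rewrite -mulr_natl natn mulr1.
by move=> j ji; rewrite eqSS -[(_ == _)]/(j == i) (negPf ji) mul0rn.
Qed.

Lemma sum_int_value (A : {mset nat}%mset) : 0%N \notin A ->
  \sum_(l <- A) int_value f l%:Z = (\sum_(l <- A) a l.-1)%:Z.
Proof.
move=> A0; rewrite (big_morph Posz PoszD erefl); apply: eq_big_seq => l lA.
by rewrite -val_atE //; case: l lA => // lA; move: A0; rewrite /in_mem /= lA.
Qed.

Lemma mset_of_0 w : 0%N \notin mset_of w.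
Proof.
rewrite -mset_eq0 mset_seqE; apply/eqP/count_memPn/negP => /flatten_mapP[i _].
by rewrite mem_nseq andbC.
Qed.

Lemma mset_of_partition w : partitions f n (mset_of w) <-> mass a w = n.
Proof.
rewrite /partitions /= mset_of_0 sum_int_value ?mset_of_0 //.
rewrite (big_mset_of w (fun l => a l.-1)) /mass.
have -> : \sum_(i < M) a i.+1.-1 *+ w i = (\sum_(i < M) a i * w i)%N.
  by apply: eq_bigr => i _; rewrite -mulr_natr natn.
by split=> [[_ []]|->].
Qed.

Lemma partition_mset_of (A : {mset nat}%mset) : partitions f n A ->
  exists w, A = mset_of w.
Proof.
move=> [A0 An]; have {}An : (\sum_(l <- A) a l.-1 = n)%N.
  by apply/eqP; rewrite -eqz_nat -An sum_int_value.
have part_le l : (A l * a l.-1 <= n)%N.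
  rewrite -An (bigID (pred1 l)) /= (leq_trans _ (leq_addr _ _)) //.
  rewrite (eq_bigr (fun=> a l.-1)) => [|i /eqP->//].
  by rewrite big_const_seq iter_addn_0 mulnC count_mem_mset.
have Ab l : (A l.+1 < b.+1)%N.
  rewrite ltnS; apply: leq_trans nb; apply: leq_trans (part_le l.+1).
  by rewrite leq_pmulr // val_at_gt0.
exists [ffun i : 'I_M => inord (A i.+1)]; apply/msetP => -[|l].
  by rewrite (mset_eq0P A0) (mset_eq0P (mset_of_0 _)).
have [lM|Ml] := ltnP l M.
  by have := mset_ofE [ffun i : 'I_M => inord (A i.+1)] (Ordinal lM); rewrite /= ffunE inordK.
have -> : A l.+1 = 0%N.
  by have := part_le l.+1; have := aM Ml; case: (A l.+1) => // m; rewrite mulSn /=; lia.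
rewrite mset_seqE; apply/esym/count_memPn/negP => /flatten_mapP[i _].
by rewrite mem_nseq => /andP[_ /eqP[il]]; have := ltn_ord i; rewrite -il; lia.
Qed.

Lemma card_partitions (p : pred nat) :
  #|` fset_set [set A : {mset nat}%mset | partitions f n A /\ p (size A)]| =
  #|[set w : conf M b | (mass a w == n) && p (nparts w)]%SET|.
Proof.
set S := [set w : conf M b | _]%SET.
have -> : [set A : {mset nat}%mset | partitions f n A /\ p (size A)] =
    [set` [fset x in [seq mset_of w | w <- enum S]]%fset].
  apply/seteqP; split => A /=.
    case=> An pA; have [w Aw] := partition_mset_of An; rewrite !inE.
    apply/mapP; exists w => //; rewrite mem_enum inE; apply/andP; split.
      by apply/eqP/mset_of_partition; rewrite -Aw.
    by rewrite -size_mset_of -Aw.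
  rewrite !inE => /mapP[w]; rewrite mem_enum inE => /andP[/eqP wn pw] ->.
  by split; [apply/mset_of_partition|rewrite size_mset_of].
rewrite set_fsetK card_fseq undup_id ?size_map -?cardE //.
rewrite map_inj_uniq ?enum_uniq // => w w' ww; apply/ffunP => i; apply/val_inj.
by rewrite /= -!mset_ofE ww.
Qed.

Lemma pf_npart : pf f n = npart a M b n.
Proof.
rewrite /pf /npart; have := card_partitions predT.
have -> : [set A : {mset nat}%mset | partitions f n A /\ predT (size A)] = partitions f n.
  by apply/seteqP; split => [A []|A].
by move=> ->; apply: eq_card => w; rewrite !inE andbT.
Qed.

Lemma pf_parts_card m :
  pf_parts f m n = #|[set w : conf M b | (mass a w == n) && (nparts w == m)]%SET|.
Proof.
rewrite -(card_partitions (pred1 m)); congr (#|` fset_set _|).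
by apply/seteqP; split => A [An /eqP Am]; split => //; apply/eqP.
Qed.

Lemma nparts_le_mass (w : conf M b) : (nparts w <= mass a w)%N.
Proof. by apply: leq_sum => i _; rewrite leq_pmull // val_at_gt0. Qed.

Lemma pf_mod_card (r : int) k :
  pf_mod f r k n =
  #|[set w : conf M b | (mass a w == n) && ((nparts w)%:Z == r %[mod k%:Z])%Z]%SET|.
Proof.
set P := fun m : nat => (m%:Z == r %[mod k%:Z])%Z.
set s := [seq m <- iota 0 n.+1 | P m].
have us : uniq s by rewrite filter_uniq // iota_uniq.
have sP : [set` s] `<=` [set m | P m] by move=> m /=; rewrite mem_filter => /andP[].
rewrite /pf_mod (fsbigE s _ us sP); last first.
  move=> m /= Pm; rewrite mem_filter Pm mem_iota add0n /= ltnS -ltnNge => nm.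
  rewrite pf_parts_card; apply/eqP; rewrite cards_eq0; apply/eqP/setP => w; rewrite !inE.
  by apply/negP => /andP[/eqP wn /eqP wm]; have := nparts_le_mass w; lia.
rewrite big_filter_cond /=.
rewrite -sum1_card (partition_big (fun w : conf M b => inord (nparts w) : 'I_n.+1) xpredT) //=.
rewrite -[0%N :: iota 1 n]/(index_iota 0 n.+1) big_mkord big_mkcond /=.
apply: eq_bigr => m _; have -> : ((m : nat) \in [set m | P m]) = P m.
  by apply/idP/idP; rewrite inE.
rewrite andbb pf_parts_card sum1dep_card -[LHS]/(if P m then _ else 0%N).
case: ifP => Pm; last first.
  apply/esym/eqP; rewrite cards_eq0; apply/eqP/setP => w; rewrite !inE.
  apply/negP => /andP[/andP[/eqP wn wP] /eqP wm]; move: Pm.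
  by rewrite -wm /P inordK ?wP // ltnS -wn nparts_le_mass.
apply: eq_card => w; rewrite !inE.
have [/eqP wn|//] := boolP (mass a w == n); rewrite /=.
have wlt : (nparts w < n.+1)%N by rewrite ltnS -wn nparts_le_mass.
rewrite -val_eqE /= inordK //; have [->|_] := eqVneq (nparts w) m; last by rewrite andbF.
by rewrite andbT -/(P m) Pm.
Qed.
End Configurations.

(** * The quantitative estimate *)

(** Adding a fixed representation of [n - j] embeds the vectors of mass [j] into those of mass
    [n]. *)
Lemma npart_mono (a : nat -> nat) M b n Q N0 :
  (forall i, (0 < a i)%N) -> (n <= b)%N -> (Q <= M)%N ->
  (forall h, (N0 <= h)%N -> exists m : nat -> nat,
    (forall i, m i != 0%N -> (i < Q)%N) /\ (\sum_(i < Q) a i * m i = h)%N) ->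
  forall j, (j + N0 <= n)%N -> (npart a M b j <= npart a M b n)%N.
Proof.
move=> a0 nb QM sg j jn.
have [|m [mQ mh]] := sg (n - j)%N; first by rewrite leq_subRL ?(leq_trans _ jn) // ?leq_addr.
have mM : (\sum_(i < M) a i * m i = n - j)%N.
  rewrite -mh (big_ord_widen M (fun i => a i * m i)%N QM) [RHS]big_mkcond /=.
  apply: eq_bigr => i _; case: ifP => // iQ.
  by have [->|/mQ] := eqVneq (m i) 0%N; rewrite ?muln0 // iQ.
pose sh (w : conf M b) : conf M b := [ffun i => inord (w i + m i)].
have shE (w : conf M b) i : mass a w = j -> sh w i = (w i + m i)%N :> nat.
  move=> wj; rewrite ffunE inordK // ltnS; apply: leq_trans nb.
  have -> : n = (mass a w + \sum_(i < M) a i * m i)%N.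
    by rewrite wj mM subnKC // (leq_trans _ jn) // leq_addr.
  rewrite /mass -big_split /= (bigD1 i) //= -mulnDr.
  by rewrite (leq_trans _ (leq_addr _ _)) // leq_pmull.
rewrite /npart -(card_in_imset (f := sh)).
  apply: subset_leq_card; apply/fintype.subsetP => _ /imsetP[w + ->].
  rewrite !inE => /eqP wj; rewrite /mass.
  under eq_bigr do rewrite (shE _ _ wj) mulnDr.
  by rewrite big_split /= mM -/(mass a w) wj subnKC // (leq_trans _ jn) // leq_addr.
move=> w w'; rewrite !inE => /eqP wj /eqP wj' ww; apply/ffunP => i; apply/val_inj => /=.
by apply/eqP; rewrite -(eqn_add2r (m i)) -!shE // ww.
Qed.

Lemma low_mono M b (w : conf M b) z z' B B' : (z <= z')%N -> (B <= B')%N ->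
  (low z B w <= low z' B' w)%N.
Proof.
move=> zz BB; apply: subset_leq_card; apply/fintype.subsetP => i; rewrite !inE.
by move=> /andP[iz wB]; rewrite (leq_trans iz zz) (leq_trans wB BB).
Qed.

(** Among natural numbers [k.-1 * r] stands for [- r] modulo [k]. *)
Lemma dvdn_eqz_mod (m r k : nat) : (0 < k)%N ->
  (k %| m + k.-1 * r)%N = (m%:Z == r%:Z %[mod k%:Z])%Z.
Proof.
move=> k0; rewrite eqz_mod_dvd -[LHS]/(k%:Z %| (m + k.-1 * r)%N%:Z)%Z PoszD PoszM.
have -> : m%:Z + k.-1%:Z * r%:Z = (m%:Z - r%:Z) + k%:Z * r%:Z.
  by rewrite -{2}(prednK k0) -addn1 PoszD; ring.
by rewrite rpredDr // dvdz_mulr.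
Qed.

Section Main.
Variables (R : realType) (f : {poly rat}).
Hypothesis f_adm : admissible f.

Local Notation d := (poly_deg f).

Lemma pf_mod_bound : exists W Y0 : nat, [/\ (0 < W)%N, (0 < Y0)%N & forall n Y k r : nat,
  (Y0 <= Y)%N -> (Y ^ d.+1 <= n)%N -> (n <= Y.+1 ^ d.+1)%N ->
  (0 < k)%N -> coprime k (Pi_ f) ->
  `|k%:R * (pf_mod f r%:Z k n)%:R - (pf f n)%:R| <=
  k%:R * (pf f n)%:R * (expR (- (Y%:R / (W%:R * k%:R ^+ 2))) +
                        2 * n.+1%:R * expR (- (Y%:R / W%:R))) :> R].
Proof.
have [C0 [a_lo a_hi]] := val_at_growth f_adm.
have a0 := val_at_gt0 f_adm; have d0 := deg_gt0 f_adm.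
have [N0 [Q sg]] := val_at_semigroup f_adm.
have [g [u [g0 uF ug kg]]] := unit_relation f_adm.
pose N := (\sum_(x <- u) `|x.2|)%N.
have uN x : x \in u -> `|x.2| <= N%:Z.
  by move=> xu; rewrite -abszE lez_nat /N (big_rem x) //= leq_addr.
set a := val_at f in a_lo a_hi a0 sg.
have Fa i : int_value f i.+1%:Z = (a i)%:Z by exact: val_atE.
have Fd := int_value_diff f_adm.
pose rho := reach d N; have rho0 : (0 < rho)%N by rewrite /rho /reach; lia.
pose B := (weight_bound d u).+1.
have [E [Y1 [K [E0 EY1 rare]]]] :=
  low_rare R d0 a0 a_lo a_hi (4 * rho) N0 (ltn0Sn (weight_bound d u)).
exists (8 * E * rho)%N, (Y1 + 2 * rho * E)%N; split.
- by rewrite !muln_gt0 E0 rho0.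
- by rewrite addn_gt0 !muln_gt0 E0 rho0 orbT.
move=> n Y k r YY Yn nY k0 kPi.
have Y1Y : (Y1 <= Y)%N by apply: leq_trans YY; rewrite leq_addr.
have EY : (2 * rho * E <= Y)%N by apply: leq_trans YY; rewrite leq_addl.
pose z := (Y %/ E)%N; pose th := (z %/ (2 * rho))%N.
have r20 : (0 < 2 * rho)%N by rewrite muln_gt0.
have z2 : (2 * rho <= z)%N by rewrite leq_divRL.
have th0 : (0 < th)%N by rewrite divn_gt0.
have zth : (z <= 4 * rho * th)%N.
  apply: leq_trans (ltnW (ltn_ceil z r20)) _; rewrite -/th.
  have -> : (4 * rho * th = (2 * th) * (2 * rho))%N by ring.
  by rewrite leq_mul2r; apply/orP; right; clearbody th; lia.
have thz : (rho * (2 * th) <= z)%N.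
  by rewrite mulnCA mulnA mulnC leq_trunc_div.
(* Indices from [C0 * n] on give parts larger than [n], and [Q] leaves room for the representations
   used in [npart_mono]. *)
pose M := (C0 * n + Q)%N; pose b := (K.+1 * n)%N.
have nb : (n <= b)%N by rewrite /b mulSn leq_addr.
have Kb : (K * n <= b)%N by rewrite /b mulSn leq_addl.
have Y0 : (0 < Y)%N by apply: leq_trans EY; rewrite muln_gt0 r20.
have Yn' : (Y <= n)%N by apply: leq_trans Yn; rewrite -[leqLHS]expn1 leq_pexp2l.
have C00 : (0 < C0)%N := growth_const_gt0 a_lo.
have YM : (Y <= M)%N by rewrite /M (leq_trans Yn') // (leq_trans _ (leq_addr _ _)) // leq_pmull.
have aM i : (M <= i)%N -> (n < a i)%N.
  move=> Mi; rewrite -(ltn_pmul2l C00); apply: leq_trans (a_lo i).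
  apply: (@leq_trans i.+1); last by rewrite -[leqLHS]expn1 leq_pexp2l.
  by rewrite ltnS (leq_trans _ Mi) // leq_addr.
have mono := npart_mono a0 nb (leq_addl _ _ : Q <= M)%N sg.
have zM : (rho * (2 * th) <= M)%N by rewrite (leq_trans thz) // (leq_trans _ YM) // leq_div.
pose T := (2 * th)%N.
have pick (t : 'I_T) := weight_pos_pick uN g0 ug zM (ltn_ord t).
have [i0 i0P] := choice pick.
have eqd := @equidistribution R a M b n T g k (k.-1 * r)
  (fun t : 'I_T => weight_pos d u N T t) (fun t : 'I_T => weight_neg d u N T t) i0 a0 nb
  (fun t => (i0P t).1) (fun t => (i0P t).2)
  (fun t => weight_pos_mass Fd uN Fa uF zM (ltn_ord t))
  (fun t => weight_pos_parts uN ug zM (ltn_ord t))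
  (fun t t' i tt => weight_pos_neg_disjoint uN (ltn_ord t) (ltn_ord t') tt)
  k0 (kg k kPi) th.
set S := [set w : conf M b | mass a w == n]%SET in eqd.
set bad := [set w in S | (#|_| < th)%N]%SET in eqd.
have pfS : pf f n = #|S| := pf_npart f_adm nb aM.
have modS : pf_mod f r%:Z k n = #|[set w in S | (k %| nparts w + k.-1 * r)%N]%SET|.
  rewrite (pf_mod_card f_adm nb aM); apply: eq_card => w.
  by rewrite !inE dvdn_eqz_mod.
rewrite modS pfS; apply: (le_trans eqd); rewrite -mulrA ler_pM2l ?ltr0n // mulrDr.
have Wr : 0 < (8 * E * rho)%:R :> R by rewrite ltr0n !muln_gt0 E0 rho0.
have kr : 0 < k%:R :> R by rewrite ltr0n.
apply: lerD.
  rewrite ler_wpM2l ?ler0n // ler_expR lerN2.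
  have Yth : (Y <= 4 * E * rho * th)%N.
    have -> : (4 * E * rho * th = (2 * th) * (2 * rho * E))%N by ring.
    have -> : th = (Y %/ (2 * rho * E))%N by rewrite /th /z -divnMA mulnC.
    have dd : (0 < 2 * rho * E)%N by rewrite !muln_gt0 rho0.
    apply: leq_trans (ltnW (ltn_ceil Y dd)) _.
    rewrite leq_mul2r; apply/orP; right.
    have : (0 < Y %/ (2 * rho * E))%N by rewrite divn_gt0.
    lia.
  rewrite ler_pdivrMr ?mulr_gt0 ?exprn_gt0 //.
  have -> : th%:R / (2 * k%:R ^+ 2) * ((8 * E * rho)%:R * k%:R ^+ 2) =
    (4 * E * rho * th)%:R :> R.
    rewrite !natrM; field; rewrite ?gt_eqF //.
  by rewrite ler_nat.
have badle : #|bad|%:R <= 2 * (n.+1 * #|S|)%:R * expR (- (Y%:R / (4 * E%:R))) :> R.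
  apply: le_trans (rare n Y M b th Y1Y Yn nY YM Kb mono zth).
  rewrite ler_nat; apply: subset_leq_card; apply/fintype.subsetP => w.
  rewrite !inE => /andP[-> gth] /=.
  (* If fewer than [th] of the [2 * th] relations are good, at least [th] multiplicities are low,
     the event bounded by [rare]. *)
  have h := card_good_ge d uN (2 * th) w.
  have h2 : (low (rho * (2 * th)) (weight_bound d u) w <= low z B w)%N by apply: low_mono.
  rewrite leqNgt; apply/negP => lowlt; suff : (2 * th < 2 * th)%N by rewrite ltnn.
  have sum_lt := leq_add (ltnW gth) (leq_ltn_trans h2 lowlt).
  by rewrite addnS addnn -mul2n in sum_lt; apply: leq_ltn_trans h sum_lt.
apply: (le_trans badle).
have -> : #|S|%:R * (2 * n.+1%:R * expR (- (Y%:R / (8 * E * rho)%:R))) =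
  2 * (n.+1 * #|S|)%:R * expR (- (Y%:R / (8 * E * rho)%:R)) :> R.
  by rewrite natrM; ring.
rewrite ler_wpM2l ?mulr_ge0 ?ler0n // ler_expR lerN2 ler_wpM2l ?ler0n //.
have le4 : 4 * E%:R <= (8 * E * rho)%:R :> R.
  by rewrite -natrM ler_nat mulnAC leq_mul2r; apply/orP; right; lia.
by rewrite lef_pV2 ?posrE // mulr_gt0 ?ltr0n.
Qed.
End Main.

(** * Asymptotics *)

Lemma nat_root (m n : nat) : exists Y : nat, (Y ^ m.+1 <= n)%N /\ (n < Y.+1 ^ m.+1)%N.
Proof.
have ex0 : exists y, (y ^ m.+1 <= n)%N by exists 0%N; rewrite exp0n.
have bnd y : (y ^ m.+1 <= n)%N -> (y <= n)%N.
  by apply: leq_trans; case: y => // y; rewrite -[leqLHS]expn1 leq_pexp2l.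
case: (ex_maxnP ex0 bnd) => Y Yn Ymax; exists Y; split => //.
by rewrite ltnNge; apply/negP => /Ymax; rewrite ltnn.
Qed.

Lemma poly_expR_small (R : realType) (W m : nat) (eps : R) : (0 < W)%N -> 0 < eps ->
  exists Y1 : nat, forall Y : nat, (Y1 <= Y)%N ->
    (2 * Y%:R) ^+ m * expR (- (Y%:R / W%:R)) <= eps.
Proof.
move=> W0 e0; have Wr : 0 < W%:R :> R by rewrite ltr0n.
pose C : R := 2 ^+ m * m.+1`!%:R * W%:R ^+ m.+1.
have C0 : 0 < C by rewrite !mulr_gt0 ?exprn_gt0 // ltr0n fact_gt0.
exists (Num.truncn (C / eps)).+1 => Y YC.
have Yr : 0 < Y%:R :> R by rewrite ltr0n (leq_trans _ YC).
have CY : C <= eps * Y%:R.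
  rewrite -ler_pdivrMl // mulrC; apply: ltW; apply: (lt_le_trans (truncnS_gt _)).
  by rewrite ler_nat.
have u0 : 0 < Y%:R / W%:R :> R by rewrite divr_gt0.
have e : expR (- (Y%:R / W%:R)) <= m.+1`!%:R / (Y%:R / W%:R) ^+ m.+1 :> R.
  apply: le_trans (expRN_ratio_le m u0); rewrite ler_pdivlMr.
    by rewrite ler_piMr ?expR_ge0 // gerBl expR_ge0.
  by rewrite subr_gt0 expR_lt1 oppr_lt0.
apply: (@le_trans _ _ ((2 * Y%:R) ^+ m * (m.+1`!%:R / (Y%:R / W%:R) ^+ m.+1))).
  by rewrite ler_wpM2l // exprn_ge0 // mulr_ge0 ?ler0n.
have -> : (2 * Y%:R) ^+ m * (m.+1`!%:R / (Y%:R / W%:R) ^+ m.+1) = C / Y%:R.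
  rewrite /C exprMn expr_div_n !exprS; field.
  by rewrite ?gt_eqF ?exprn_gt0.
by rewrite ler_pdivrMr.
Qed.

Lemma ln_ge1 (R : realType) (n : nat) : (4 <= n)%N -> 1 <= ln n%:R :> R.
Proof.
move=> n4; have n0 : 0 < n%:R :> R by rewrite ltr0n (leq_trans _ n4).
rewrite -ler_expR lnK //; apply: (@le_trans _ _ 4); last by rewrite ler_nat.
have := expRN_nat_ge R 1; rewrite expr1 expRN lef_pV2 ?posrE ?expR_gt0 //.
Qed.

(** Squaring turns the exponent into [1 / (d + 1)] and the logarithms cancel, leaving
    [n ^ (1 / (d + 1)) <= Y + 1]. *)
Lemma growth_sqr_le (R : realType) (d n Y : nat) : (4 <= n)%N -> (n < Y.+1 ^ d.+1)%N ->
  (n%:R `^ (1 / (2 + 2 * d%:R)) * (ln n%:R) `^ (- (1 / 2))) ^+ 2 * ln n%:R <= Y.+1%:R :> R.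
Proof.
move=> n4 nY; have l1 := @ln_ge1 R n n4; set l := ln _ in l1 *.
set A := _ `^ (1 / (2 + _)); have A0 : 0 <= A by apply: powR_ge0.
have d0 : 0 <= d%:R :> R by rewrite ler0n.
have -> : (A * l `^ (- (1 / 2))) ^+ 2 * l = A ^+ 2.
  rewrite exprMn -(powR_mulrn 2 (powR_ge0 l (- (1 / 2)))) -powRrM.
  have -> : - (1 / 2) * 2%:R = - 1 :> R by field.
  by rewrite powRN powRr1 ?divfK // ?gt_eqF; lra.
rewrite -(@ler_pXn2r _ d.+1) ?nnegrE ?exprn_ge0 // -exprM.
rewrite -powR_mulrn // -powRrM.
have -> : 1 / (2 + 2 * d%:R) * (2 * d.+1)%:R = 1 :> R.
  by rewrite natrM -natr1; field; lra.
by rewrite powRr1 ?ler0n // -natrX ler_nat ltnW.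
Qed.

Theorem corollary1p2 (R : realType) (f : {poly rat}) (a k : nat -> nat) :
  admissible f ->
  (forall n : nat, (0 < n)%N ->
    [/\ (0 < a n)%N, (0 < k n)%N & coprime (k n) (Pi_ f)]) ->
  (fun n : nat => (k n)%:R : R^o) =o_\oo
    (fun n : nat =>
       (n%:R `^ (1 / (2 + 2 * (poly_deg f)%:R)) * (ln n%:R) `^ (- (1 / 2)) : R^o)) ->
  (fun n : nat => (pf_mod f (a n)%:Z (k n) n)%:R : R^o) ~_\oo
    (fun n : nat => ((k n)%:R^-1 * (pf f n)%:R : R^o)).
Proof.
move=> f_adm ak /eqoP ko; apply/eqaddoP => eps eps0.
have [W [Y0 [W0 Y00 bound]]] := pf_mod_bound R f_adm.
have Wr : 1 <= W%:R :> R by rewrite ler1n.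
have Wr0 : 0 < W%:R :> R by rewrite ltr0n.
set d := poly_deg f in ko bound.
have d0 : (0 < d)%N := deg_gt0 f_adm.
have e2 : 0 < eps / 8 by rewrite divr_gt0.
(* The factor [2 * k * (n + 1)] is at most [4 * n ^ 2], hence [4 * (2 * Y) ^ (2 * d.+1)]; [eps / 8]
   absorbs the 4 and leaves [eps / 2]. *)
have [Y1 small] := poly_expR_small (2 * d.+1) W0 e2.
pose N := (maxn 4 (maxn (maxn Y0 Y1 ^ d.+1) (Num.truncn (2 / eps)).+1))%N.
have dl0 : 0 < (2 * W%:R)^-1 :> R by rewrite invr_gt0 mulr_gt0.
near=> n.
have nN : (N <= n)%N by near: n; exact: nbhs_infty_ge.
have n4 : (4 <= n)%N by apply: leq_trans nN; rewrite leq_maxl.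
have nY01 : (maxn Y0 Y1 ^ d.+1 <= n)%N.
  by apply: leq_trans nN; rewrite /N !leq_max leqnn !orbT.
have ne : 2 / eps <= n%:R.
  apply: ltW; apply: (lt_le_trans (truncnS_gt _)); rewrite ler_nat.
  by apply: leq_trans nN; rewrite /N !leq_max leqnn !orbT.
have n0 : (0 < n)%N by apply: leq_trans n4.
have [_ k0 kPi] := ak n n0.
have kn : `|(k n)%:R : R^o| <= (2 * W%:R)^-1 *
   `|n%:R `^ (1 / (2 + 2 * d%:R)) * (ln n%:R) `^ (- (1 / 2)) : R^o|.
  by near: n; exact: ko.
have [Y [Yn nY]] := nat_root d n.
have YY : (maxn Y0 Y1 <= Y)%N.
  by rewrite -ltnS -(@ltn_exp2r _ _ d.+1) // (leq_ltn_trans nY01).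
have Y0Y : (Y0 <= Y)%N by apply: leq_trans YY; rewrite leq_maxl.
have Y1Y : (Y1 <= Y)%N by apply: leq_trans YY; rewrite leq_maxr.
have Ypos : (0 < Y)%N by apply: leq_trans Y0Y.
have := bound n Y (k n) (a n) Y0Y Yn (ltnW nY) k0 kPi.
set K : R := (k n)%:R; set p : R := (pf f n)%:R; set pm : R := (pf_mod _ _ _ _)%:R => bd.
have K1 : 1 <= K by rewrite ler1n.
have Kpos : 0 < K by apply: lt_le_trans K1.
have p0 : 0 <= p by rewrite ler0n.
have Yr : 1 <= Y%:R :> R by rewrite ler1n.
have nr : 1 <= n%:R :> R by rewrite ler1n.
have l1 := @ln_ge1 R n n4.
(* Equivalently [Y / (W * K ^ 2) >= 2 * ln n]: the first exponential is at most [n ^ -2], which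
   beats the factor [K <= n]. *)
have K2 : K ^+ 2 * ln n%:R <= Y%:R / (2 * W%:R).
  have {}kn : K <= (2 * W%:R)^-1 *
    (n%:R `^ (1 / (2 + 2 * d%:R)) * (ln n%:R) `^ (- (1 / 2))).
    by move: kn; rewrite !ger0_norm ?mulr_ge0 ?powR_ge0 ?ler0n.
  have gr := growth_sqr_le R n4 nY; set G := n%:R `^ _ * (ln n%:R) `^ _ in gr kn.
  have G0 : 0 <= G by rewrite mulr_ge0 ?powR_ge0.
  have KG : K ^+ 2 <= ((2 * W%:R)^-1 * G) ^+ 2.
    by rewrite lerXn2r // nnegrE ?(ltW Kpos) // mulr_ge0 // ltW.
  apply: (@le_trans _ _ ((2 * W%:R)^-1 ^+ 2 * (G ^+ 2 * ln n%:R))).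
    by rewrite mulrA -exprMn ler_wpM2r //; lra.
  apply: (@le_trans _ _ ((2 * W%:R)^-1 ^+ 2 * (2 * Y%:R))).
    rewrite ler_wpM2l ?exprn_ge0 ?(ltW dl0) //; apply: (le_trans gr).
    by rewrite -(natr1 Y); lra.
  rewrite expr2 -mulrA [leRHS]mulrC ler_pM2l // -mulrC ler_pdivrMr ?mulr_gt0 //; nra.
have Kn : K <= n%:R.
  apply: (@le_trans _ _ (K ^+ 2)); first by rewrite expr2 ler_peMr // ltW.
  apply: (@le_trans _ _ (K ^+ 2 * ln n%:R)); first by rewrite ler_peMr // exprn_ge0 // ltW.
  apply: (le_trans K2); apply: (@le_trans _ _ Y%:R).
    by rewrite ler_pdivrMr ?mulr_gt0 //; nra.
  rewrite ler_nat; apply: leq_trans Yn; by rewrite -[leqLHS]expn1 leq_pexp2l.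
have first_small : K * expR (- (Y%:R / (W%:R * K ^+ 2))) <= eps / 2.
  apply: (@le_trans _ _ (n%:R * expR (- (ln n%:R + ln n%:R)))).
    apply: ler_pM; rewrite ?expR_ge0 ?(ltW Kpos) // ler_expR lerN2.
    rewrite ler_pdivlMr ?mulr_gt0 ?exprn_gt0 //.
    move: K2; rewrite ler_pdivlMr ?mulr_gt0 //.
    by apply: le_trans; rewrite le_eqVlt; apply/orP; left; apply/eqP; ring.
  rewrite opprD expRD expRN lnK ?posrE; last by rewrite ltr0n.
  rewrite mulrA divff ?mul1r; last by rewrite gt_eqF // ltr0n.
  by rewrite -[leRHS]invrK invf_div lef_pV2 // posrE ?divr_gt0 // ltr0n.
have second_small : K * (2 * n.+1%:R * expR (- (Y%:R / W%:R))) <= eps / 2.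
  have n2 : K * (2 * n.+1%:R) <= 4 * (2 * Y%:R) ^+ (2 * d.+1).
    have nYr : n%:R <= (2 * Y%:R) ^+ d.+1 :> R.
      rewrite -natrM -natrX ler_nat; apply: (leq_trans (ltnW nY)).
      by rewrite leq_exp2r // mul2n -addnn -addn1 leq_add2l.
    rewrite [(2 * d.+1)%N]mulnC exprM; set P := _ ^+ d.+1 in nYr *.
    apply: (@le_trans _ _ (n%:R * (2 * (2 * n%:R)))); last by nra.
    apply: ler_pM => //; rewrite ?(ltW Kpos) // ?mulr_ge0 // ler_pM2l //.
    by rewrite -(natr1 n); lra.
  rewrite mulrA; apply: (@le_trans _ _ (4 * (2 * Y%:R) ^+ (2 * d.+1) * expR (- (Y%:R / W%:R)))).
    by rewrite ler_wpM2r ?expR_ge0.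
  rewrite -mulrA; have := small Y Y1Y; lra.
rewrite -[X in `|X| <= _]/(pm - K^-1 * p).
have -> : pm - K^-1 * p = K^-1 * (K * pm - p) by field; rewrite ?gt_eqF.
rewrite !normrM (ger0_norm p0) (@ger0_norm _ K^-1) ?invr_ge0 ?(ltW Kpos) //.
rewrite mulrCA ler_pM2l ?invr_gt0 //; apply: (le_trans bd).
rewrite [K * p]mulrC -[leLHS]mulrA [leRHS]mulrC ler_wpM2l // mulrDr.
by rewrite [leRHS](splitr eps); apply: lerD.
Unshelve. all: by end_near.
Qed.
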